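(* Let $a$ be an integer with $a\neq0,\pm1$, and let $a=\pm a_0^e$, where $e$ is the largest positive integer such that $|a|$ is a perfect $e$-th power and $a_0$ is the integer with $|a|=|a_0|^e$ and $\operatorname{sign}(a_0)=\operatorname{sign}(a)$. Write $e=\prod_p p^{\nu_p(e)}$, and let $D$ be the discriminant of $K=\mathbb{Q}(a_0^{1/2})$. For $n\ge1$ let $K_n=\mathbb{Q}(\zeta_n,a^{1/n})$. (1) If $e$ is odd or $a>0$, then $$\sum_{n\geq1}\frac{1}{[K_n:\mathbb{Q}]}=\left(1+\frac{c_0}{3\cdot2^{\nu_2(e)}-2}\prod_{p\mid2D}\frac{p^{\nu_p(e)+2}+p^{\nu_p(e)+1}-p^2}{p^{\nu_p(e)+3}+p^{\nu_p(e)}-p^2}\right)\prod_p\left(1+\frac{p^{\nu_p(e)+2}+p^{\nu_p(e)+1}-p^2}{p^{\nu_p(e)}(p-1)(p^2-1)}\right),$$ where $$c_0=\begin{cases}1/4&\text{if } 4\Vert D \text{ and } \nu_2(e)=0,\text{ or if } 8\Vert D \text{ and } \nu_2(e)=1,\\ 1/16&\text{if } 8\Vert D \text{ and } \nu_2(e)=0,\\ 1&\text{otherwise.}\end{cases}$$ (2) If $e$ is even and $a<0$, then $$\sum_{n\geq1}\frac{1}{[K_n:\mathbb{Q}]}=\left(1+\frac{c_0}{3\cdot2^{\nu_2(e)+2}-2}\prod_{\substack{p\mid D\\ p\neq 2}}\frac{p^{\nu_p(e)+2}+p^{\nu_p(e)+1}-p^2}{p^{\nu_p(e)+3}+p^{\nu_p(e)}-p^2}\right)\left(1+\frac{2^{\nu_2(e)+2}-2^{\nu_2(e)}-1}{3\cdot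 2^{\nu_2(e)}}\right)\prod_{p\neq 2}\left(1+\frac{p^{\nu_p(e)+2}+p^{\nu_p(e)+1}-p^2}{p^{\nu_p(e)}(p-1)(p^2-1)}\right),$$ where $$c_0=\begin{cases}4&\text{if } 8\Vert D \text{ and } \nu_2(e)=1,\\ 1&\text{otherwise.}\end{cases}$$
   Context: Here $p$ always runs over primes; $\zeta_n$ is a primitive $n$-th root of unity in a fixed algebraic closure $\overline{\mathbb{Q}}$ of $\mathbb{Q}$, so $K_n=\mathbb{Q}(\zeta_n,a^{1/n})$ is the splitting field of $x^n-a$ over $\mathbb{Q}$. $\nu_p(e)$ is the exponent of $p$ in $e$ (equal to $0$ if $p\nmid e$). The notation $2^j\Vert D$ means $2^j\mid D$ and $2^{j+1}\nmid D$. *)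

(* Defs.v *)
From HB Require Import structures.
From mathcomp Require Import all_boot all_order all_algebra all_field.
From mathcomp Require Import all_classical all_reals all_analysis.

Set Implicit Arguments.
Unset Strict Implicit.
Unset Printing Implicit Defensive.

Import Order.TTheory GRing.Theory Num.Theory.
Import numFieldNormedType.Exports.

Local Open Scope classical_set_scope.
Local Open Scope ring_scope.

(* [num_field_exists s] provides a number field together with an embedding
   into [algC] whose image is exactly the subfield generated by [s]. *)
Definition Qadj (s : seq algC) : fieldExtType rat := tag (num_field_exists s).

Definition degQ (s : seq algC) : nat := \dim {: Qadj s}.

Definition is_perfect_power (k m : nat) : Prop := exists b : nat, m = (b ^ k)%N.

Definition is_max_exponent (e m : nat) : Prop :=
  [/\ (0 < e)%N, is_perfect_power e m &
      forall k : nat, (0 < k)%N -> is_perfect_power k m -> (k <= e)%N].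

Definition algebraic_integer (L : fieldExtType rat) (x : L) : Prop :=
  integralOver (intr : int -> L) x.

(* Trace of the Q-linear endomorphism y |-> x * y of L. *)
Definition traceQ (L : fieldExtType rat) (x : L) : rat :=
  \tr (passmx.mxof (vbasis {: L}) (vbasis {: L}) (amull x)).

(* Uniqueness of the integer coordinates follows from Q-linear independence. *)
Definition is_integral_basis (L : fieldExtType rat)
    (b : (\dim {: L}).-tuple L) : Prop :=
  [/\ basis_of {: L} b,
      forall i : 'I_(\dim {: L}), algebraic_integer (tnth b i) &
      forall x : L, algebraic_integer x ->
        exists c : 'I_(\dim {: L}) -> int, x = \sum_i tnth b i *~ c i].

(* The value does not depend on the integral basis, so at most one D
   satisfies this. *)
Definition is_discriminant (L : fieldExtType rat) (D : int) : Prop :=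
  exists2 b : (\dim {: L}).-tuple L, is_integral_basis b &
    D%:~R = \det (\matrix_(i, j) traceQ (tnth b i * tnth b j)).

Definition exactly_divides (d j : nat) (D : int) : bool :=
  ((d ^ j)%N%:Z %| D)%Z && ~~ ((d ^ j.+1)%N%:Z %| D)%Z.

Definition c0_case1 (R : realType) (D : int) (e : nat) : R :=
  if (exactly_divides 2 2 D && (logn 2 e == 0%N))
     || (exactly_divides 2 3 D && (logn 2 e == 1%N)) then 1 / 4
  else if exactly_divides 2 3 D && (logn 2 e == 0%N) then 1 / 16
  else 1.

Definition c0_case2 (R : realType) (D : int) (e : nat) : R :=
  if exactly_divides 2 3 D && (logn 2 e == 1%N) then 4 else 1.

Definition disc_factor (R : realType) (e p : nat) : R :=
  let v := logn p e in
  (p%:R ^+ (v + 2) + p%:R ^+ (v + 1) - p%:R ^+ 2)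
  / (p%:R ^+ (v + 3) + p%:R ^+ v - p%:R ^+ 2).

Definition euler_factor (R : realType) (e p : nat) : R :=
  let v := logn p e in
  1 + (p%:R ^+ (v + 2) + p%:R ^+ (v + 1) - p%:R ^+ 2)
      / (p%:R ^+ v * (p%:R - 1) * (p%:R ^+ 2 - 1)).

(* Partial product over the primes p < N satisfying P. *)
Definition prime_prod (R : realType) (P : pred nat) (F : nat -> R) (N : nat) : R :=
  \prod_(0 <= p < N | prime p && P p) F p.

(* Main.v *)
Require Import Defs.
From HB Require Import structures.
From mathcomp Require Import all_boot all_order all_algebra all_field.
From mathcomp Require Import zify ring lra.
From mathcomp Require Import all_classical all_reals all_analysis.

Set Implicit Arguments.
Unset Strict Implicit.
Unset Printing Implicit Defensive.

Import Order.TTheory GRing.Theory Num.Theory.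
Import numFieldNormedType.Exports.

Local Open Scope classical_set_scope.
Local Open Scope ring_scope.

(** Let F be the field of n-th roots of unity and alpha an n-th root of a. As F
    contains the roots of unity, Kummer theory gives the degree of K_n over F as
    the least m > 0 with alpha^m in F, so that the reciprocal of [K_n : Q] is
    t / (n phi(n)) with t = n / m; and a divisor j of n divides t if and only if
    alpha^(n/j) is in F (degQ_radical, kummer_index).

    The index t is nearly determined by the exponent e. If y is an n-th root of
    a rational number and y is in F, then y times its complex conjugate is fixed
    by all automorphisms, because the Galois group of F is abelian; so it is
    rational (radical_norm_rational). By the maximality of e this implies that t
    divides 2 e. Conversely the gcd of n and e divides t when a = a0^e, and a
    small modification of it does when a = - |a0|^e with e even. There remains a
    factor 2, which is decided by whether sqrt a0, or its product with a root of
    unity of order a power of 2, is in F (kummer_index_perfect,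
    kummer_index_twisted_odd, kummer_index_twisted_even).

    Now sqrt a0 is in F exactly when the discriminant D of Q(sqrt a0) divides n
    (sqrt_cyclotomicP): the square roots of p* = (-1)^((p-1)/2) p, of -1 and of 2
    are explicit expressions in roots of unity, and if a factor of D is missing
    from n then some automorphism trivial on F changes the sign of sqrt a0. The
    number D itself is computed from an arbitrary integral basis by comparison
    with 1, sqrt d or 1, (1 + sqrt d)/2 (quad_discriminant_tuple).

    So t is a multiplicative function of n, doubled under a condition which
    bears on the valuations of n at the primes of 2 D separately. The sum of the
    reciprocal degrees is thus a sum of two Euler products that differ at these
    primes only (euler_product_cvg, restricted_euler_product). The local factors
    are geometric sums; their quotients at the primes of 2 D give the correction
    term, and c0 measures by how much the condition at 2 is stronger, or weaker,
    than in the generic case. *)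

(** * Membership in Q(z) and the automorphisms of the algebraic numbers *)

(** Polynomial expressions in z with rational coefficients: for an algebraic
    number z they already form the field Q(z). *)
Definition inQ (z w : algC) : Prop := exists p : {poly rat}, w = (map_poly ratr p).[z].

Lemma inQ_rat z r : inQ z (ratr r).
Proof. by exists r%:P; rewrite map_polyC hornerC. Qed.

Lemma inQ_int z (m : int) : inQ z m%:~R.
Proof. by rewrite -(ratr_int _ m); apply: inQ_rat. Qed.

Lemma inQ_nat z (m : nat) : inQ z m%:R.
Proof. exact: inQ_int z m. Qed.

Lemma inQ_gen z : inQ z z.
Proof. by exists 'X; rewrite map_polyX hornerX. Qed.

Lemma inQD z x y : inQ z x -> inQ z y -> inQ z (x + y).
Proof. by move=> [p ->] [q ->]; exists (p + q); rewrite rmorphD hornerD. Qed.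

Lemma inQM z x y : inQ z x -> inQ z y -> inQ z (x * y).
Proof. by move=> [p ->] [q ->]; exists (p * q); rewrite rmorphM hornerM. Qed.

Lemma inQN z x : inQ z x -> inQ z (- x).
Proof. by move=> [p ->]; exists (- p); rewrite rmorphN hornerN. Qed.

Lemma inQX z x k : inQ z x -> inQ z (x ^+ k).
Proof. by move=> [p ->]; exists (p ^+ k); rewrite rmorphXn horner_exp. Qed.

Lemma inQ_trans z w u : inQ z w -> inQ w u -> inQ z u.
Proof.
by move=> [p ->] [q ->]; exists (q \Po p); rewrite map_comp_poly horner_comp.
Qed.

Lemma inQ_root n (z w : algC) : n.-primitive_root z -> w ^+ n = 1 -> inQ z w.
Proof.
by move=> zP /(prim_rootP zP)[i ->]; apply/inQX/inQ_gen.
Qed.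

Lemma inQ_root_dvd n m (z w : algC) :
  n.-primitive_root z -> (m %| n)%N -> w ^+ m = 1 -> inQ z w.
Proof.
by move=> zP /dvdnP[k kE] wm; apply: (inQ_root zP); rewrite kE mulnC exprM wm expr1n.
Qed.

Lemma aut_horner_rat (nu : {rmorphism algC -> algC}) (p : {poly rat}) z :
  nu (map_poly ratr p).[z] = (map_poly ratr p).[nu z].
Proof.
rewrite -horner_map -map_poly_comp; congr (_.[_]).
by apply: eq_map_poly => x /=; rewrite fmorph_rat.
Qed.

Lemma inQ_aut (mu nu : {rmorphism algC -> algC}) z w :
  inQ z w -> mu z = nu z -> mu w = nu w.
Proof. by move=> [p ->] eqz; rewrite !aut_horner_rat eqz. Qed.

Lemma inQ_fixed (nu : {rmorphism algC -> algC}) z w :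
  inQ z w -> nu z = z -> nu w = w.
Proof. exact: (@inQ_aut nu idfun). Qed.

(** Write w = r(z) with r reduced modulo the cyclotomic polynomial. The
    automorphisms z |-> z^k show that r takes the value w at all phi(n)
    primitive n-th roots of unity; as r - w has degree below phi(n) it is
    zero, and w is the constant coefficient of r. *)
Lemma inQ_fixed_Crat n (z w : algC) : n.-primitive_root z -> inQ z w ->
  (forall nu : {rmorphism algC -> algC}, nu w = w) -> w \in Crat.
Proof.
move=> zP [f wE] fixw.
have [p [pE pM] _] := minCpolyP z.
have szp : size p = (totient n).+1.
  by rewrite -(size_map_poly (ratr : {rmorphism rat -> algC})) -pE
             (minCpoly_cyclotomic zP) size_cyclotomic.
pose r := f %% p.
have rE (x : algC) : n.-primitive_root x -> (map_poly ratr r).[x] = (map_poly ratr f).[x].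
  move=> xP; rewrite [in RHS](divp_eq f p) rmorphD rmorphM hornerD hornerM /=.
  rewrite -pE (minCpoly_cyclotomic zP).
  have /rootP -> : root (cyclotomic z n) x by rewrite root_cyclotomic.
  by rewrite mulr0 add0r.
pose g : {poly algC} := map_poly ratr r - w%:P.
have g0 : g = 0.
  apply/eqP; case: eqVneq => // gN0.
  have := @max_poly_roots _ g [seq z ^+ k | k <- iota 0 n & coprime k n] gN0.
  rewrite size_map size_filter.
  have -> : count (coprime^~ n) (iota 0 n) = totient n.
    rewrite totient_count_coprime -sum1_count /index_iota subn0 big_mkcond /=.
    by apply: eq_bigr => i _; rewrite coprime_sym; case: coprime.
  have szg : (size g <= totient n)%N.
    rewrite (leq_trans (size_polyD _ _)) // geq_max size_polyN size_map_poly.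
    rewrite -ltnS -szp ltn_modp monic_neq0 //=.
    by rewrite (leq_trans (size_polyC_leq1 _)) // totient_gt0 (prim_order_gt0 zP).
  rewrite ltnNge szg /= => Hroots.
  suff [all_r uniq_r] : all (root g) [seq z ^+ k | k <- iota 0 n & coprime k n] /\ uniq
    [seq z ^+ k | k <- iota 0 n & coprime k n].
    by have := Hroots all_r uniq_r.
  split.
    apply/allP => x /mapP[k]; rewrite mem_filter mem_iota => /andP[co _] ->.
    rewrite rootE hornerD hornerN hornerC rE ?prim_root_exp_coprime//.
    have [nu nuP] := Qn_aut_exists co.
    have <- : nu z = z ^+ k by apply/nuP/prim_expr_order.
    by rewrite -aut_horner_rat -wE fixw subrr.
  rewrite map_inj_in_uniq ?filter_uniq ?iota_uniq//.
  move=> i j; rewrite !mem_filter !mem_iota /= !add0n => /andP[_ ilt] /andP[_ jlt].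
  by move=> /eqP; rewrite (eq_prim_root_expr zP) !modn_small // => /eqP.
have -> : w = (map_poly ratr r)`_0.
  by move/(congr1 (fun q : {poly algC} => q`_0))/eqP: g0;
    rewrite coefB coefC coef0 subr_eq0 => /eqP ->.
by rewrite coef_map Crat_rat.
Qed.

(** * The degree of a radical extension of a cyclotomic field *)

Section RadicalDegree.

Variables (L : fieldExtType rat) (iota : {rmorphism L -> algC}).

(** Degrees live in an abstract number field L, automorphisms in algC; this
    carries membership in Q(z) from one to the other. *)
Lemma inQ_Fadjoin (z1 y : L) : inQ (iota z1) (iota y) <-> y \in <<1; z1>>%VS.
Proof.
have iotaE (p : {poly rat}) :
    iota (map_poly (in_alg L) p).[z1] = (map_poly ratr p).[iota z1].
  rewrite -horner_map -map_poly_comp; congr (_.[_]).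
  by apply: eq_map_poly => a /=; rewrite alg_num_field fmorph_rat.
split=> [[p yE]|/Fadjoin1_polyP[p ->]]; last by exists p; rewrite iotaE.
by apply/Fadjoin1_polyP; exists p; apply: (fmorph_inj iota); rewrite iotaE.
Qed.

Lemma adjoin_degree_prim_root n (z1 : L) :
  n.-primitive_root z1 -> adjoin_degree 1 z1 = totient n.
Proof.
move=> z1P.
have zP : n.-primitive_root (iota z1) by rewrite fmorph_primitive_root.
have [p [pE pM] dvdp] := minCpolyP (iota z1).
have szp : size p = (totient n).+1.
  by rewrite -(size_map_poly (ratr : {rmorphism rat -> algC})) -pE
             (minCpoly_cyclotomic zP) size_cyclotomic.
have map_alg (q : {poly rat}) :
    map_poly iota (map_poly (in_alg L) q) = map_poly ratr q.
  rewrite -map_poly_comp; apply: eq_map_poly => a /=.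
  by rewrite alg_num_field fmorph_rat.
apply/eqP; rewrite -eqSS -size_minPoly -szp eqn_leq; apply/andP; split.
  rewrite -(size_map_poly (in_alg L) p) dvdp_leq //.
    by rewrite map_poly_eq0 monic_neq0.
  apply: minPoly_dvdp; first exact: alg_polyOver.
  by rewrite -(fmorph_root iota) map_alg dvdp.
have [q qE] : exists q, minPoly 1 z1 = map_poly (in_alg L) q.
  have cP i : exists a, (minPoly 1 z1)`_i = in_alg L a.
    by apply/vlineP; apply/polyOverP/minPolyOver.
  exists (\poly_(i < size (minPoly 1 z1)) sval (cid (cP i))).
  apply/polyP => i; rewrite coef_map coef_poly; case: ltnP => [_|le_i].
    by case: cid.
  by rewrite [LHS]nth_default //= scale0r.
rewrite qE size_map_poly dvdp_leq //.
  by rewrite -(map_poly_eq0 (in_alg L)) -qE monic_neq0 ?monic_minPoly.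
by rewrite -dvdp -map_alg fmorph_root -qE root_minPoly.
Qed.

(** Kummer theory. The minimal polynomial of x1 over K divides X^n - c, whose
    roots are the z1^i * x1; its constant coefficient is therefore a root of
    unity of K times x1^d, d being the degree, so x1^d is in K. A smaller
    positive power x1^r in K would give the annihilating polynomial X^r - x1^r
    of degree below d. *)
Lemma adjoin_degree_radical n (K : {subfield L}) (z1 x1 c : L) :
    n.-primitive_root z1 -> z1 \in K -> c \in K -> c != 0 -> x1 ^+ n = c ->
  forall m, (x1 ^+ m \in K) = (adjoin_degree K x1 %| m)%N.
Proof.
move=> z1P z1K cK cN0 x1n; have n_gt0 := prim_order_gt0 z1P.
have x1N0 : x1 != 0.
  by apply: contraNneq cN0 => x10; rewrite -x1n x10 expr0n gtn_eqF.
set d := adjoin_degree K x1.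
have splitXn : 'X^n - c%:P = \prod_(i <- index_iota 0 n) ('X - (z1 ^+ i * x1)%:P).
  have szXn : size ('X^n - c%:P) = n.+1 by rewrite size_XnsubC.
  have := @all_roots_prod_XsubC _ ('X^n - c%:P) [seq z1 ^+ i * x1 | i <- index_iota 0 n].
  rewrite szXn size_map size_iota subn0 big_map (monicP (monicXnsubC _ _)) // scale1r.
  apply=> //.
    apply/allP => y /mapP[i _ ->].
    rewrite rootE !hornerE exprMn exprAC (prim_expr_order z1P) expr1n mul1r x1n.
    by rewrite subrr.
  rewrite uniq_rootsE map_inj_in_uniq ?iota_uniq // => i j.
  rewrite !mem_index_iota => /andP[_ ilt] /andP[_ jlt] /(mulIf x1N0)/eqP.
  by rewrite (eq_prim_root_expr z1P) !modn_small // => /eqP.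
have polyXn m y : y \in K -> 'X^m - y%:P \is a polyOver K.
  by move=> yK; rewrite rpredB ?polyOverXn ?polyOverC.
have xdK : x1 ^+ d \in K.
  have : minPoly K x1 %| 'X^n - c%:P.
    by rewrite minPoly_dvdp ?polyXn // rootE !hornerE x1n subrr.
  rewrite splitXn => /dvdp_prod_XsubC[s]; set r := mask _ _.
  rewrite eqp_monic ?monic_minPoly ?monic_prod_XsubC // => /eqP minE.
  have szr : size r = d.
    by have := size_minPoly K x1; rewrite minE size_prod_XsubC => -[].
  pose u := \prod_(i <- r) - (z1 ^+ i).
  have uK : u \in K by rewrite rpred_prod // => i _; rewrite rpredN rpredX.
  have uN0 : u != 0.
    rewrite prodf_seq_neq0; apply/allP => i _ /=.
    by rewrite oppr_eq0 expf_neq0 // (prim_root_eq0 z1P) gtn_eqF.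
  have : (minPoly K x1).[0] \in K by rewrite rpred_horner ?minPolyOver ?rpred0.
  rewrite minE horner_prod.
  under eq_bigr do rewrite !hornerE -mulNr.
  rewrite big_split /= -/u big_const_seq count_predT szr iter_mulr_1 => uxK.
  by rewrite -(mulKf uN0 (x1 ^+ d)) rpredM ?rpredV.
have d_gt0 : (0 < d)%N by [].
move=> m; apply/idP/idP => [xmK|/dvdnP[q ->]]; last by rewrite mulnC exprM rpredX.
rewrite /dvdn -leqn0 leqNgt; apply/negP => r_gt0.
have xrK : x1 ^+ (m %% d) \in K.
  have xqN0 : x1 ^+ (m %/ d * d) != 0 by rewrite expf_neq0.
  rewrite -(mulKf xqN0 (x1 ^+ _)) -exprD -divn_eq rpredM ?rpredV //.
  by rewrite mulnC exprM rpredX.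
have : minPoly K x1 %| 'X^(m %% d) - (x1 ^+ (m %% d))%:P.
  by rewrite minPoly_dvdp ?polyXn // rootE !hornerE subrr.
move/dvdp_leq; rewrite monic_neq0 ?monicXnsubC // size_minPoly size_XnsubC //.
by move/(_ isT); rewrite ltnS leqNgt ltn_mod d_gt0.
Qed.

End RadicalDegree.

Lemma degQ_radical n (z x : algC) (c : int) :
    n.-primitive_root z -> c != 0 -> x ^+ n = c%:~R ->
  exists m0, [/\ (0 < m0)%N, degQ [:: z; x] = (totient n * m0)%N &
                 forall m, inQ z (x ^+ m) <-> (m0 %| m)%N].
Proof.
move=> zP cN0 xn; rewrite /degQ /Qadj.
case: num_field_exists => L [iota [s1 s1E gen]] /=.
case: s1 s1E gen => [|z1 [|x1 [|? ?]]] //= [z1E x1E] gen.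
have z1P : n.-primitive_root z1 by rewrite -(fmorph_primitive_root iota) z1E.
have x1n : x1 ^+ n = c%:~R.
  by apply: (fmorph_inj iota); rewrite rmorphXn /= x1E xn rmorph_int.
pose K := <<1; z1>>%AS.
exists (adjoin_degree K x1); split => //.
  rewrite -gen adjoin_cons adjoin_seq1 dim_Fadjoin dim_Fadjoin dimv1 muln1.
  by rewrite (adjoin_degree_prim_root iota z1P) mulnC.
move=> m; rewrite -z1E -x1E -rmorphXn /= inQ_Fadjoin.
rewrite -[X in _ <-> is_true X](adjoin_degree_radical (K := K) z1P _ _ _ x1n) //.
- exact: memv_adjoin.
- by rewrite rpred_int.
- by rewrite -(fmorph_eq0 iota) rmorph_int intr_eq0.
Qed.

(** * Perfect powers and the norm of a radical *)

Lemma perfect_power_logn l m : (0 < m)%N ->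
  (forall p, prime p -> (l %| logn p m)%N) -> is_perfect_power l m.
Proof.
move=> m_gt0 ldvd; exists (\prod_(p <- primes m) p ^ (logn p m %/ l))%N.
rewrite (big_endo (expn^~ l)) ?exp1n //; last by move=> x y; rewrite expnMn.
rewrite [LHS](prod_prime_decomp m_gt0) prime_decompE big_map /=.
apply: eq_big_seq => p; rewrite mem_primes => /and3P[p_pr _ _].
by rewrite -expnM divnK // ldvd.
Qed.

(** A number which is both a k-th and an e-th power is an lcm(k, e)-th power,
    as its prime valuations show; the maximality of e gives lcm(k, e) = e. *)
Lemma max_exponent_dvd e k m : (0 < m)%N -> is_max_exponent e m ->
  (0 < k)%N -> is_perfect_power k m -> (k %| e)%N.
Proof.
move=> m_gt0 [e_gt0 [c mc] emax] k_gt0 [b mb].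
have : (lcmn k e <= e)%N.
  apply: emax; first by rewrite lcmn_gt0 k_gt0 e_gt0.
  apply: perfect_power_logn => // p _.
  by rewrite dvdn_lcm {1}mb mc !lognX !dvdn_mulr.
move=> le; have <- : lcmn k e = e.
  by apply/eqP; rewrite eqn_leq le dvdn_leq ?dvdn_lcmr ?lcmn_gt0 ?k_gt0 ?e_gt0.
exact: dvdn_lcml.
Qed.

(** Divide both exponents by g = gcd(n, j): they become coprime, so m is a
    perfect (n/g)-th power and n/g divides e. *)
Lemma max_exponent_power_dvd e m c n j : (0 < m)%N -> is_max_exponent e m ->
  (0 < n)%N -> (c ^ n = m ^ j)%N -> (n %| j * e)%N.
Proof.
move=> m_gt0 emax n_gt0 cn.
have g_gt0 : (0 < gcdn n j)%N by rewrite gcdn_gt0 n_gt0.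
have n'_gt0 : (0 < n %/ gcdn n j)%N by rewrite divn_gt0 // dvdn_leq ?dvdn_gcdl.
have /(max_exponent_dvd m_gt0 emax n'_gt0) : is_perfect_power (n %/ gcdn n j) m.
  apply: perfect_power_logn => // p _.
  have co : coprime (n %/ gcdn n j) (j %/ gcdn n j).
    by rewrite /coprime -(eqn_pmul2r g_gt0) muln_gcdl !divnK ?dvdn_gcdl ?dvdn_gcdr //
      mul1n.
  rewrite -(Gauss_dvdr _ co) -(dvdn_pmul2r g_gt0) divnK ?dvdn_gcdl //.
  by rewrite mulnAC divnK ?dvdn_gcdr // -lognX -cn lognX dvdn_mulr.
move=> n'_dvd; rewrite -(divnK (dvdn_gcdl n j)) mulnC dvdn_mul ?dvdn_gcdr //.
Qed.

Lemma inQ_conj n (z w : algC) : n.-primitive_root z -> inQ z w -> inQ z w^*.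
Proof.
move=> zP wz; apply: (@inQ_trans z z^*).
  apply: (inQ_root zP); rewrite -rmorphXn /= (prim_expr_order zP); exact: rmorph1.
by case: wz => p ->; exists p; rewrite aut_horner_rat.
Qed.

(** The Galois group of Q(z) is abelian, so its elements commute with complex
    conjugation; they map y to another n-th root of b, so they preserve
    |y|^2 = y y^*. This number is thus rational, and being integral and
    nonnegative it is the required c. *)
Lemma radical_norm_rational n (z y : algC) (b : int) : n.-primitive_root z ->
  inQ z y -> y ^+ n = b%:~R -> exists c : nat, (c ^ n = `|b| ^ 2)%N.
Proof.
move=> zP zy yn; have n_gt0 := prim_order_gt0 zP.
pose rho := y * y^*.
have rhoE : rho = `|y| ^+ 2 by rewrite normCK.
have zrho : inQ z rho by apply: inQM => //; exact: (inQ_conj zP zy).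
have rhoQ : rho \in Crat.
  apply: (inQ_fixed_Crat zP zrho) => nu.
  have comm : nu y^* = (nu y)^*.
    pose f : {rmorphism algC -> algC} := (nu \o Num.conj)%FUN.
    pose g : {rmorphism algC -> algC} := (Num.conj \o nu)%FUN.
    apply: (inQ_aut (mu := f) (nu := g) zy).
    exact: (aut_unity_rootC nu Num.conj n_gt0 (prim_expr_order zP)).
  rewrite /rho rmorphM /= comm -!normCK; congr (_ ^+ 2).
  apply/eqP; rewrite -(@eqrXn2 _ n) ?normr_ge0 //; apply/eqP.
  by rewrite -!normrX -rmorphXn /= yn rmorph_int.
have rhon : rho ^+ n = (`|b| ^ 2)%N%:R.
  by rewrite rhoE exprAC -normrX yn -intr_norm natrX; congr (_ ^+ 2).
have rhoA : rho \in Aint.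
  apply: (@root_monic_Aint ('X^n - ((`|b| ^ 2)%N%:R)%:P)).
  - by rewrite rootE !hornerE rhon subrr.
  - exact: monicXnsubC.
  - by apply/polyOverP => i; rewrite coefB coefXn coefC -mulrb; case: (i == 0)%N;
    rewrite ?mulr1n ?mulr0n rpredB ?rpred_nat ?rpred0.
have : rho \in Num.nat by rewrite natrEint Cint_rat_Aint // rhoE exprn_ge0.
move=> /natrP[c cE]; exists c.
by apply/eqP; rewrite -(eqr_nat algC) natrX -cE rhon.
Qed.

(** * Cyclotomic numbers and the square root of a signed prime *)

(** The field generated by the n-th roots of unity; by inCycP the choice of the
    primitive root is immaterial. *)
Definition inCyc n (w : algC) : Prop := exists2 z : algC, n.-primitive_root z & inQ z w.

Lemma inCycP n (z w : algC) : n.-primitive_root z -> inCyc n w <-> inQ z w.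
Proof.
move=> zP; split=> [[x xP xw]|zw]; last by exists z.
by apply: (inQ_trans _ xw); apply: (inQ_root zP); rewrite prim_expr_order.
Qed.

Lemma inCyc_gt0 n w : inCyc n w -> (0 < n)%N.
Proof. by case=> z /prim_order_gt0. Qed.

Lemma inCyc_dvd n m w : (0 < m)%N -> (n %| m)%N -> inCyc n w -> inCyc m w.
Proof.
move=> m_gt0 nm [x xP xw]; have [z zP] := C_prim_root_exists m_gt0.
exists z => //; apply: (inQ_trans _ xw).
by apply: (inQ_root_dvd zP nm); rewrite prim_expr_order.
Qed.

Lemma inCycM n u w : inCyc n u -> inCyc n w -> inCyc n (u * w).
Proof.
move=> [z zP zu] /(inCycP _ zP) zw; exists z => //; exact: inQM.
Qed.

Lemma inCyc_rat n r : (0 < n)%N -> inCyc n (ratr r).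
Proof.
by move=> /C_prim_root_exists[z zP]; exists z => //; apply: inQ_rat.
Qed.

Lemma inCyc_int n (c : int) : (0 < n)%N -> inCyc n c%:~R.
Proof.
by move=> /C_prim_root_exists[z zP]; exists z => //; apply: inQ_int.
Qed.

Lemma inCyc_root n w : (0 < n)%N -> w ^+ n = 1 -> inCyc n w.
Proof.
by move=> /C_prim_root_exists[z zP] wn; exists z => //; apply: (inQ_root zP).
Qed.

Lemma inCyc_sqr n (u w : algC) : u ^+ 2 = w ^+ 2 -> inCyc n u -> inCyc n w.
Proof.
move=> /eqP; rewrite eqf_sqr => /orP[]/eqP-> //.
case=> z zP zw; exists z => //; rewrite -(opprK w); exact: inQN.
Qed.

Lemma inCyc_fixed n k (nu : {rmorphism algC -> algC}) w :
    (forall x, x ^+ n = 1 -> nu x = x ^+ k) -> k = 1 %[mod n] ->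
  inCyc n w -> nu w = w.
Proof.
move=> nuP k1 [z zP zw]; apply: (inQ_fixed zw).
have /eqP zk : z ^+ k == z ^+ 1 by rewrite (eq_prim_root_expr zP) k1.
by rewrite nuP ?zk ?expr1 // prim_expr_order.
Qed.

(** For coprime n and m an automorphism may be prescribed independently on the
    n-th and on the m-th roots of unity. *)
Lemma cyclotomic_aut_chinese n m k : coprime n m -> coprime k m ->
  exists l (nu : {rmorphism algC -> algC}),
    [/\ l = 1 %[mod n], l = k %[mod m] &
        forall x, x ^+ (n * m) = 1 -> nu x = x ^+ l].
Proof.
move=> co_nm co_km; pose l := chinese n m 1 k.
have ln : l = 1 %[mod n] by rewrite (chinese_modl co_nm).
have lm : l = k %[mod m] by rewrite (chinese_modr co_nm).
have co : coprime l (n * m).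
  by rewrite coprimeMr -coprime_modl ln coprime_modl coprime1n /=
             -coprime_modl lm coprime_modl.
by have [nu nuP] := Qn_aut_exists co; exists l, nu.
Qed.

(** The value at 1 of (X^n - 1) / (X - 1) = 1 + X + ... + X^(n-1). *)
Lemma prod_one_sub_prim_root n (z : algC) : n.-primitive_root z ->
  \prod_(1 <= i < n) (1 - z ^+ i) = n%:R.
Proof.
move=> zP; have n_gt0 := prim_order_gt0 zP.
have := factor_Xn_sub_1 zP; rewrite subrX1 big_ltn // expr0 => /mulfI.
have X1 : 'X - 1 != 0 :> {poly algC} by rewrite polyXsubC_eq0.
move=> /(_ X1)/(congr1 (horner^~ 1)).
rewrite horner_prod horner_sum => E.
transitivity (\prod_(1 <= i < n) ('X - (z ^+ i)%:P).[1]).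
  by apply: eq_bigr => i _; rewrite !hornerE.
rewrite {}E (eq_bigr (fun=> 1)) => [|i _]; last by rewrite hornerXn expr1n.
by rewrite sumr_const card_ord.
Qed.

(** Pair the factors of indices i and p - i in p = prod_i (1 - z^i): since
    1 - z^(p-i) = - z^(p-i) (1 - z^i), the prime p is (-1)^((p-1)/2) times a
    power of z times the square of the half product, and every power of z is a
    square because p is odd. *)
Lemma sqrt_prime_star p : prime p -> odd p ->
  exists2 w, inCyc p w & w ^+ 2 = (-1) ^+ p./2 * p%:R.
Proof.
move=> p_pr p_odd; have p_gt0 := prime_gt0 p_pr.
have [z zP] := C_prim_root_exists p_gt0.
set h := p./2; have pE : p = h.*2.+1 by rewrite -[LHS]odd_double_half p_odd.
pose M := (\sum_(1 <= i < h.+1) (p - i))%N.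
pose P := \prod_(1 <= i < h.+1) (1 - z ^+ i).
have pP : p%:R = (-1) ^+ h * z ^+ M * P ^+ 2.
  rewrite -(prod_one_sub_prim_root zP) (@big_cat_nat _ _ _ h.+1) /=; last 2 first.
  - by [].
  - by rewrite pE ltnS -addnn leq_addr.
  (* Reverse the upper half of the product: i becomes p - i. *)
  have -> : \prod_(h.+1 <= i < p) (1 - z ^+ i) =
            \prod_(1 <= i < h.+1) (1 - z ^+ (p - i)).
    rewrite big_nat_rev /= big_add1 /= [RHS]big_add1 /= -[h in LHS]add0n.
    rewrite big_addn.
    have -> : (p.-1 - h = h)%N by rewrite pE /= -addnn addnK.
    apply: eq_big_nat => i /andP[_ ih]; congr (1 - z ^+ _).
    by rewrite pE; lia.
  rewrite -big_split /= /M expr_sum.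
  rewrite expr2 mulrA -!mulrA.
  have -> : (-1) ^+ h = \prod_(1 <= i < h.+1) (-1 : algC).
    by rewrite prodr_const_nat subn1.
  rewrite /P -!big_split /=; apply: eq_big_nat => i /andP[i1 ih].
  have zi : z ^+ (p - i) * z ^+ i = 1.
    by rewrite -exprD subnK ?prim_expr_order // pE; lia.
  by rewrite -{2}zi; ring.
exists (z ^+ (M * h.+1) * P).
  exists z => //; apply: inQM; first exact/inQX/inQ_gen.
  rewrite /P; elim/big_rec: _ => [|i x _ IH]; first exact: inQ_nat z 1%N.
  apply: inQM IH; apply: inQD; first exact: inQ_nat z 1%N.
  exact/inQN/inQX/inQ_gen.
rewrite exprMn -exprM -mulnA muln2 doubleS -pE mulnS exprD mulnC exprM.
rewrite (prim_expr_order zP) expr1n mulr1.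
by rewrite pP mulrA mulrA -exprD addnn -signr_odd odd_double expr0 mul1r.
Qed.

(** * Square roots of squarefree integers *)

Definition squarefree (m : nat) : Prop := forall p, prime p -> ~~ (p ^ 2 %| m)%N.

Lemma squarefree_dvd m k : (m %| k)%N -> squarefree k -> squarefree m.
Proof. by move=> mk sqf p /sqf; apply: contra => /dvdn_trans; apply. Qed.

Lemma squarefree_gt0 m : squarefree m -> (0 < m)%N.
Proof. by case: m => // /(_ 2%N isT). Qed.

Lemma squarefree_prime_dvd m n : squarefree m ->
  (forall p, prime p -> (p %| m)%N -> (p %| n)%N) -> (m %| n)%N.
Proof.
elim/ltn_ind: m => m IH sqf pn; have m_gt0 := squarefree_gt0 sqf.
have [->|m_neq1] := eqVneq m 1%N; first exact: dvd1n.
have m_gt1 : (1 < m)%N by rewrite ltn_neqAle eq_sym m_neq1.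
set p := pdiv m; have p_pr : prime p := pdiv_prime m_gt1.
have /dvdnP[k mE] : (p %| m)%N := pdiv_dvd m.
have k_dvd : (k %| m)%N by rewrite mE dvdn_mulr.
have co : coprime k p.
  rewrite coprime_sym prime_coprime //; apply: contra (sqf p p_pr) => /dvdnP[j kE].
  by rewrite mE kE -mulnA dvdn_mull.
rewrite mE Gauss_dvd // (pn p) // ?pdiv_dvd // andbT.
apply: IH.
- have k_gt0 : (0 < k)%N by case: k mE {k_dvd co} => // m0; rewrite m0 in m_gt0.
  by rewrite [X in (_ < X)%N]mE ltn_Pmulr // prime_gt1.
- exact: squarefree_dvd sqf.
- by move=> q q_pr qk; apply: pn => //; apply: dvdn_trans qk k_dvd.
Qed.

(** Here, as in sqrt_pm2, the square root comes with an automorphism which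
    changes its sign: this is what sqrt_not_cyclotomic consumes. *)
Lemma sqrt_N1 : exists2 v, inCyc 4 v & v ^+ 2 = -1 /\
  forall nu : {rmorphism algC -> algC},
    (forall x, x ^+ 4 = 1 -> nu x = x ^+ 3) -> nu v = - v.
Proof.
have [z zP] := C_prim_root_exists (isT : (0 < 4)%N).
have z4 := prim_expr_order zP.
have z2 : z ^+ 2 = -1.
  have : (z ^+ 2) ^+ 2 == 1 by rewrite -exprM z4.
  rewrite sqrf_eq1 => /orP[|/eqP//].
  by rewrite -(expr0 z) (eq_prim_root_expr zP).
exists z; first by exists z => //; apply: inQ_gen.
by split=> // nu ->; rewrite // exprS z2 mulrN1.
Qed.

Lemma sqrt_pm2 (s : algC) : s = 2 \/ s = -2 -> exists2 v, inCyc 8 v & v ^+ 2 = s /\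
  forall nu : {rmorphism algC -> algC},
    (forall x, x ^+ 8 = 1 -> nu x = x ^+ 5) -> nu v = - v.
Proof.
have [z zP] := C_prim_root_exists (isT : (0 < 8)%N).
have z8 := prim_expr_order zP.
have z4 : z ^+ 4 = -1.
  have : (z ^+ 4) ^+ 2 == 1 by rewrite -exprM z8.
  rewrite sqrf_eq1 => /orP[|/eqP//].
  by rewrite -(expr0 z) (eq_prim_root_expr zP).
have nuz (nu : {rmorphism algC -> algC}) :
    (forall x, x ^+ 8 = 1 -> nu x = x ^+ 5) -> nu z = - z.
  by move=> ->; rewrite // exprS z4 mulrN1.
have zz : inQ z z := inQ_gen z.
(* For a suitable choice of i and of sqrt 2, z = (1 + i) / sqrt 2, whence
   z - z^3 = sqrt 2 and z + z^3 = i sqrt 2. *)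
case=> ->; [exists (z - z ^+ 3) | exists (z + z ^+ 3)].
- by exists z => //; apply: inQD => //; apply/inQN/inQX.
- split=> [|nu /nuz nuE]; last by rewrite rmorphB rmorphXn /= nuE; ring.
  transitivity (z ^+ 2 * (1 + z ^+ 4) - 2 * z ^+ 4); first by ring.
  by rewrite z4; ring.
- by exists z => //; apply: inQD => //; apply/inQX.
- split=> [|nu /nuz nuE]; last by rewrite rmorphD rmorphXn /= nuE; ring.
  transitivity (z ^+ 2 * (1 + z ^+ 4) + 2 * z ^+ 4); first by ring.
  by rewrite z4; ring.
Qed.

(** The prime factors of d contribute the square roots of the p* = p or -p
    that are 1 modulo 4; a product of such p* is 1 modulo 4, so it is d and
    not -d. *)
Lemma sqrt_1mod4 (d : int) : squarefree `|d|%N -> (d %% 4)%Z = 1 ->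
  exists2 w, inCyc `|d|%N w & w ^+ 2 = d%:~R.
Proof.
move=> sqf d1.
suff [w [s [wm w2 sm s1]]] : exists w (s : int),
    [/\ inCyc `|d|%N w, w ^+ 2 = s%:~R, `|s|%N = `|d|%N & (s %% 4)%Z = 1].
  by exists w => //; rewrite w2; have -> : s = d by lia.
have : odd `|d|%N by lia.
move: `|d|%N sqf => m {d d1}; elim/ltn_ind: m => m IH sqf m_odd.
have [->|m_neq1] := eqVneq m 1%N.
  exists 1, 1; rewrite expr1n; split=> //; exact: (@inCyc_int 1 1).
have m_gt0 := squarefree_gt0 sqf.
have m_gt1 : (1 < m)%N by rewrite ltn_neqAle eq_sym m_neq1.
set p := pdiv m; have p_pr : prime p := pdiv_prime m_gt1.
have /dvdnP[k mE] : (p %| m)%N := pdiv_dvd m.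
have k_dvd : (k %| m)%N by rewrite mE dvdn_mulr.
have /andP[k_odd p_odd] : odd k && odd p by rewrite -oddM -mE.
have k_lt : (k < m)%N.
  by rewrite [X in (_ < X)%N]mE ltn_Pmulr ?prime_gt1 //; case: k k_odd {mE k_dvd}.
have [u [s [uk u2 sk s1]]] := IH k k_lt (squarefree_dvd k_dvd sqf) k_odd.
have [v vp v2] := sqrt_prime_star p_pr p_odd.
exists (u * v), (s * ((-1) ^+ p./2 * p%:Z)); split.
- apply: inCycM; first exact: inCyc_dvd m_gt0 k_dvd uk.
  by apply: inCyc_dvd m_gt0 _ vp; apply: pdiv_dvd.
- by rewrite exprMn u2 v2 !rmorphM rmorphXn rmorphN1.
- by rewrite !abszM sk abszX /= exp1n mul1n -mE.
- rewrite -signr_odd; have := odd_double_half p; rewrite p_odd.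
  have := odd_double_half p./2; rewrite -!muln2.
  have {}s1 : exists t, s = 4 * t + 1 by exists (s %/ 4)%Z; lia.
  case: s1 => t ->; case: odd => pE1 pE2.
    have -> : (4 * t + 1) * ((-1) ^+ true * p%:Z) = 4 * (- t * p%:Z - (p./2./2)%:Z - 1)
      + 1.
      rewrite expr1; lia.
    by lia.
  have -> : (4 * t + 1) * ((-1) ^+ false * p%:Z) = 4 * (t * p%:Z + (p./2./2)%:Z) + 1.
    rewrite expr0; lia.
  by lia.
Qed.

(** * The conductor of a quadratic field *)

(** The discriminant of Q(sqrt d) for d squarefree, d <> 1. *)
Definition quad_disc (d : int) : int := if (d %% 4)%Z == 1 then d else 4 * d.

Lemma two_mod4_split (d : int) : (d %% 4)%Z = 2 -> exists d' s : int,
  [/\ (d' %% 4)%Z = 1, s = 2 \/ s = -2 & d = s * d'].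
Proof.
move=> d2; have [h|h] : ((d %/ 2)%Z %% 4)%Z = 1 \/ ((d %/ 2)%Z %% 4)%Z = 3 by lia.
  by exists (d %/ 2)%Z, 2; split; [lia|left|lia].
by exists (- (d %/ 2)%Z), (-2); split; [lia|right|lia].
Qed.

(** Up to the factor i (if d is 3 modulo 4) or sqrt 2 or sqrt (-2) (if d is
    even), d is 1 modulo 4 and sqrt_1mod4 applies; the extra factor accounts
    for the 4 or the 8 in the discriminant. *)
Lemma sqrt_in_quad_disc (d : int) : squarefree `|d|%N ->
  exists2 w, inCyc `|quad_disc d|%N w & w ^+ 2 = d%:~R.
Proof.
move=> sqf; have d_gt0 := squarefree_gt0 sqf; rewrite /quad_disc.
have nd4 : (d %% 4)%Z <> 0 by move=> d0; have := sqf 2%N isT; lia.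
case: eqP => [d1|/eqP d_n1]; first exact: sqrt_1mod4.
have [d3|d2] : (d %% 4)%Z = 3 \/ (d %% 4)%Z = 2 by move/eqP: d_n1; lia.
  have [|//|w wd w2] := @sqrt_1mod4 (- d); first by rewrite abszN.
    by lia.
  have [v v4 [v2 _]] := sqrt_N1.
  exists (v * w); last by rewrite exprMn v2 w2 rmorphN /=; ring.
  rewrite abszN in wd; apply: inCycM.
  - by apply: inCyc_dvd v4; rewrite abszM ?muln_gt0 ?dvdn_mulr.
  - by apply: inCyc_dvd wd; rewrite abszM ?muln_gt0 ?dvdn_mull.
have [d' [s [d'1 sE ds]]] := two_mod4_split d2.
have d'd : (`|d'| %| `|d|)%N by rewrite ds abszM dvdn_mull.
have [//|w wd w2] := sqrt_1mod4 (squarefree_dvd d'd sqf).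
have [|v v8 [v2 _]] := @sqrt_pm2 s%:~R.
  by case: sE => ->; [left|right].
exists (v * w); last by rewrite exprMn v2 w2 ds rmorphM.
have E : `|(4 * d)%R|%N = (8 * `|d'|)%N by rewrite ds; case: sE => ->; lia.
have d'_gt0 : (0 < `|d'|)%N by lia.
have E8 : (0 < 8 * `|d'|)%N by rewrite muln_gt0.
rewrite E; apply: inCycM.
  by apply: inCyc_dvd v8 => //; apply: dvdn_mulr.
by apply: inCyc_dvd wd => //; apply: dvdn_mull.
Qed.

Lemma sqrt_in_8 (d : int) : squarefree `|d|%N ->
  exists2 w, inCyc (8 * `|d|)%N w & w ^+ 2 = d%:~R.
Proof.
move=> sqf; have d_gt0 := squarefree_gt0 sqf.
have [w wd w2] := sqrt_in_quad_disc sqf; exists w => //.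
apply: inCyc_dvd wd; rewrite ?muln_gt0 // /quad_disc.
by case: ifP => _; [rewrite dvdn_mull|rewrite abszM dvdn_mul].
Qed.

(** An automorphism which is 1 modulo N1 and k modulo N2 fixes u and the n-th
    roots of unity but changes the sign of v, hence that of w. *)
Lemma sqrt_not_cyclotomic n N1 N2 k (u v w : algC) :
    w != 0 -> w ^+ 2 = (u * v) ^+ 2 -> coprime N1 N2 -> coprime k N2 ->
    inCyc N1 u ->
    (forall nu : {rmorphism algC -> algC},
       (forall x, x ^+ N2 = 1 -> nu x = x ^+ k) -> nu v = - v) ->
    (n %| N1 * N2)%N ->
    (forall l, l = 1 %[mod N1] -> l = k %[mod N2] -> l = 1 %[mod n])%N ->
  ~ inCyc n w.
Proof.
move=> wN0 w2 co_N co_k uN1 vflip nN cong wn.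
have [l [nu [l1 lk nuP]]] := cyclotomic_aut_chinese co_N co_k.
have fixn x m : (m %| N1 * N2)%N -> l = 1 %[mod m] -> inCyc m x -> nu x = x.
  move=> /dvdnP[j jE] lm; apply: inCyc_fixed lm => y ym; apply: nuP.
  by rewrite jE mulnC exprM ym expr1n.
have nuu : nu u = u by apply: fixn l1 uN1; rewrite dvdn_mulr.
have nuv : nu v = - v.
  apply: vflip => x xN2; rewrite nuP; last by rewrite mulnC exprM xN2 expr1n.
  by rewrite -(expr_mod l xN2) lk expr_mod.
have nuw : nu w = w by apply: fixn wn => //; apply: cong.
have nuwN : nu w = - w.
  move/eqP: w2; rewrite eqf_sqr => /orP[]/eqP->.
    by rewrite rmorphM /= nuu nuv mulrN.
  by rewrite rmorphN rmorphM /= nuu nuv mulrN.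
move: nuwN; rewrite nuw => /eqP; rewrite -subr_eq0 opprK -mulr2n.
by rewrite mulrn_eq0 (negPf wN0).
Qed.

Lemma squarefree_prime p : prime p -> squarefree p.
Proof.
move=> p_pr q q_pr; rewrite pfactor_dvdn ?prime_gt0 // logn_prime //.
by case: (_ == _).
Qed.

Lemma squarefree_nonsquare (d : int) (r : rat) :
  squarefree `|d|%N -> d != 1 -> r ^+ 2 != d%:~R.
Proof.
move=> sqf d_neq1; have d_gt0 := squarefree_gt0 sqf; apply/eqP => rE.
have dE : (numq r ^+ 2 = d * denq r ^+ 2).
  by apply: (@intr_inj rat); rewrite !(rmorphXn, rmorphM) /= numqE exprMn rE.
have den_gt0 : (0 < `|denq r|)%N by rewrite absz_gt0 denq_neq0.
have : `|d|%N <> 1%N.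
  move=> d1; have dN1 : d = -1 by move/eqP: d_neq1; lia.
  by have := sqr_ge0 r; rewrite rE dN1.
move=> /eqP d1; have d_gt1 : (1 < `|d|)%N by rewrite ltn_neqAle eq_sym d1.
have p_pr := pdiv_prime d_gt1; set p := pdiv _ in p_pr.
move: dE => /(congr1 absz); rewrite abszX abszM abszX => /(congr1 (logn p)).
rewrite lognX lognM ?expn_gt0 ?den_gt0 // lognX.
have -> : logn p `|d|%N = 1%N.
  apply/eqP; rewrite eqn_leq logn_gt0 mem_primes p_pr d_gt0 pdiv_dvd andbT.
  by rewrite leqNgt -(pfactor_dvdn 2 p_pr d_gt0) sqf.
by lia.
Qed.

(** If no automorphism moved w then w would be rational, and d a square. *)
Lemma sqrt_flip n (d : int) (w : algC) : squarefree `|d|%N -> d != 1 ->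
    w ^+ 2 = d%:~R -> inCyc n w ->
  exists nu : {rmorphism algC -> algC}, nu w = - w.
Proof.
move=> sqf d_neq1 w2 [z zP zw].
have [nu nuw] : exists nu : {rmorphism algC -> algC}, nu w <> w.
  apply/existsNP => fixw.
  have /CratP[c cE] := inQ_fixed_Crat zP zw fixw.
  have /eqP[] := squarefree_nonsquare c sqf d_neq1.
  apply: (fmorph_inj (ratr : {rmorphism rat -> algC})).
  by rewrite rmorphXn /= -cE w2 rmorph_int.
exists nu; have : nu w ^+ 2 == w ^+ 2 by rewrite -rmorphXn /= w2 rmorph_int.
by rewrite eqf_sqr => /orP[/eqP//|/eqP].
Qed.

Lemma sqrt_prime_flip p (v : algC) : prime p -> inCyc p v ->
    v ^+ 2 = p%:R \/ v ^+ 2 = - p%:R ->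
  exists2 k, coprime k p & forall nu : {rmorphism algC -> algC},
    (forall x, x ^+ p = 1 -> nu x = x ^+ k) -> nu v = - v.
Proof.
move=> p_pr vp v2.
have [d [sqf d_neq1 v2d]] : exists d : int,
    [/\ squarefree `|d|%N, d != 1 & v ^+ 2 = d%:~R].
  have p_sqf := squarefree_prime p_pr; have p_gt1 := prime_gt1 p_pr.
  by case: v2 => ->; [exists p%:Z|exists (- p%:Z); rewrite abszN rmorphN];
    split=> //; apply/eqP; lia.
have [mu muv] := sqrt_flip sqf d_neq1 v2d vp; case: vp => z zP zv.
have [k co muz] := aut_prim_rootP mu zP.
exists k => // nu nuP; rewrite -muv.
by apply: (inQ_aut zv); rewrite muz nuP ?(prim_expr_order zP).
Qed.

Lemma odd_part_dvd n : (0 < n)%N -> (forall j, ~~ (2 ^ j.+1 %| n) -> n %| 2 ^ j *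
  n`_(2^'))%N.
Proof.
move=> n_gt0 j nj; rewrite -{1}(partnC 2%N n_gt0) dvdn_pmul2r ?part_gt0 // p_part.
rewrite dvdn_exp2l // leqNgt; apply: contra nj => ltj.
by rewrite pfactor_dvdn.
Qed.

(** One direction is the explicit root of sqrt_in_quad_disc. Conversely, if an
    odd prime p, or the 4 or the 8, of the discriminant does not divide n, then
    sqrt p*, i or sqrt (+-2) changes its sign under an automorphism that is
    trivial on the n-th roots of unity and on the remaining factor of sqrt d. *)
Theorem sqrt_cyclotomicP (d : int) n (w : algC) :
    squarefree `|d|%N -> w ^+ 2 = d%:~R -> (0 < n)%N ->
  inCyc n w <-> (`|quad_disc d|%N %| n)%N.
Proof.
move=> sqf w2 n_gt0; have d_gt0 := squarefree_gt0 sqf.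
split=> [wn|dn]; last first.
  have [u ud u2] := sqrt_in_quad_disc sqf.
  by apply: (@inCyc_sqr _ u); rewrite ?u2 ?w2 //; apply: inCyc_dvd ud.
have dN0 : d != 0 by rewrite -absz_gt0.
have wN0 : w != 0.
  by apply: contraNneq dN0 => w0; rewrite -(intr_eq0 algC) -w2 w0 expr0n.
have odd_dvd p : prime p -> odd p -> (p %| `|d|)%N -> (p %| n)%N.
  move=> p_pr p_odd pd; apply: contraT => pn; exfalso.
  have [v vp v2] := sqrt_prime_star p_pr p_odd.
  have v2' : v ^+ 2 = p%:R \/ v ^+ 2 = - p%:R.
    rewrite v2 -signr_odd; case: odd; rewrite ?expr1 ?expr0 ?mul1r ?mulN1r;
      by [left|right].
  have [k co_k flip] := sqrt_prime_flip p_pr vp v2'.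
  pose d' := (d %/ ((-1) ^+ p./2 * p%:Z))%Z.
  have dE : d = d' * ((-1) ^+ p./2 * p%:Z).
    by rewrite divzK // dvdzE abszM abszX exp1n mul1n.
  have absE : `|d|%N = (`|d'| * p)%N by rewrite dE !abszM abszX exp1n mul1n.
  have d'd : (`|d'| %| `|d|)%N by rewrite absE dvdn_mulr.
  have [u ud u2] := sqrt_in_8 (squarefree_dvd d'd sqf).
  have d'_gt0 : (0 < `|d'|)%N by move: d_gt0; rewrite absE muln_gt0 => /andP[].
  have pd' : ~~ (p %| `|d'|)%N.
    by apply: contra (sqf p p_pr) => pd'; rewrite absE expnS expn1 dvdn_mul.
  (* The factor 8 makes room for the square root of the cofactor d', whatever
     its residue modulo 4. *)
  pose N1 := (8 * `|d'| * n)%N.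
  have co_N : coprime N1 p.
    rewrite !coprimeMl ![coprime _ p]coprime_sym !prime_coprime // pd' pn !andbT.
    by apply: contraL p_odd => p8; move: (p8 : (p %| 2 ^ 3)%N);
      rewrite Euclid_dvdX // dvdn_prime2 // => /andP[/eqP->].
  apply: (sqrt_not_cyclotomic (n := n) (N1 := N1) (u := u) wN0 _ co_N co_k _ flip _ _ wn).
  - by rewrite exprMn u2 v2 w2 dE !rmorphM rmorphXn rmorphN1.
  - apply: inCyc_dvd ud; last exact: dvdn_mulr.
    by rewrite /N1 !muln_gt0 d'_gt0 n_gt0.
  - by rewrite /N1 -mulnA mulnCA dvdn_mulr.
  - move=> l l1 _; apply/eqP; have := dvdn_mull (8 * `|d'|) (dvdnn n).
    by move=> /modn_dvdm <-; rewrite l1 modn_dvdm // dvdn_mull.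
have odd_sqf_dvd m : odd m -> (m %| `|d|)%N -> (m %| n)%N.
  move=> m_odd md; apply: squarefree_prime_dvd (squarefree_dvd md sqf) _.
  move=> p p_pr pm; apply: odd_dvd => //; last exact: dvdn_trans pm md.
  by apply: contraLR m_odd => p_even; rewrite -dvdn2; apply: dvdn_trans pm; rewrite dvdn2.
have cong j l : (n %| 2 ^ j * n`_2^' -> l = 1 %[mod n`_2^'] -> l = 1 %[mod 2 ^ j] ->
    l = 1 %[mod n])%N.
  move=> nj l1 l2; have /eqP : (l == 1 %[mod 2 ^ j * n`_2^'])%N.
    rewrite chinese_remainder ?l1 ?l2 ?eqxx // coprimeXl // coprime2n.
    by have := part_pnat (negn 2%N) n; rewrite odd_2'nat.
  by move=> ll; rewrite -(modn_dvdm l nj) ll modn_dvdm.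
have modW l m m' k : (m' %| m -> l = k %[mod m] -> l = k %[mod m'])%N.
  by move=> m'm lk; rewrite -(modn_dvdm l m'm) lk modn_dvdm.
have n'_gt0 : (0 < n`_2^')%N by rewrite part_gt0.
have n'_odd : odd (n`_2^')%N by have := part_pnat (negn 2%N) n; rewrite odd_2'nat.
have d_n0 : (d %% 4)%Z <> 0 by move=> d0; have := sqf 2%N isT; lia.
rewrite /quad_disc; case: eqP => [d1|d_n1].
  by apply: odd_sqf_dvd => //; lia.
have [d3|d2] : (d %% 4)%Z = 3 \/ (d %% 4)%Z = 2 by lia.
  have d_odd : odd `|d|%N by lia.
  rewrite abszM Gauss_dvd ?(odd_sqf_dvd `|d|%N) ?andbT //; last first.
    by rewrite -[X in coprime X _]/(2 ^ 2)%N coprimeXl // coprime2n.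
  apply: contraT => n4; exfalso; have nj := odd_part_dvd n_gt0 (j := 1) n4.
  have [|//|u ud u2] := @sqrt_1mod4 (- d); first by rewrite abszN.
    by lia.
  have [v v4 [v2 flip]] := sqrt_N1.
  rewrite abszN in ud.
  apply: (sqrt_not_cyclotomic (n := n) (N1 := (`|d| * n`_2^')%N) (u := u) wN0
    _ _ _ _ flip _ _ wn) => //.
  - by rewrite exprMn u2 v2 w2 rmorphN /=; ring.
  - by rewrite -[X in coprime _ X]/(2 ^ 2)%N coprimeXr // coprimen2 oddM d_odd.
  - by apply: inCyc_dvd ud; rewrite ?muln_gt0 ?d_gt0 ?dvdn_mulr.
  - apply: dvdn_trans nj _; apply/dvdnP; exists (2 * `|d|)%N.
    by rewrite expn1; lia.
  - move=> l l1 l3; apply: (cong 1%N) => //.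
      exact: modW (dvdn_mull _ (dvdnn _)) l1.
    exact: (modW l 4%N 2%N 3%N).
have [d' [s [d'1 sE ds]]] := two_mod4_split d2.
have d'd : (`|d'| %| `|d|)%N by rewrite ds abszM dvdn_mull.
have d'_odd : odd `|d'|%N by lia.
have d'_gt0 : (0 < `|d'|)%N by lia.
have -> : `|(4 * d)%R|%N = (8 * `|d'|)%N by rewrite ds; case: sE => ->; lia.
rewrite Gauss_dvd ?(odd_sqf_dvd `|d'|%N) ?andbT //;
  last by rewrite -[X in coprime X _]/(2 ^ 3)%N coprimeXl // coprime2n.
apply: contraT => n8; exfalso; have nj := odd_part_dvd n_gt0 (j := 2) n8.
have [//|u ud u2] := sqrt_1mod4 (squarefree_dvd d'd sqf).
have [|v v8 [v2 flip]] := @sqrt_pm2 s%:~R.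
  by case: sE => ->; [left|right].
apply: (sqrt_not_cyclotomic (n := n) (N1 := (`|d'| * n`_2^')%N) (u := u) wN0
    _ _ _ _ flip _ _ wn) => //.
- by rewrite exprMn u2 v2 w2 ds rmorphM mulrC.
- by rewrite -[X in coprime _ X]/(2 ^ 3)%N coprimeXr // coprimen2 oddM d'_odd.
- by apply: inCyc_dvd ud; rewrite ?muln_gt0 ?d'_gt0 ?dvdn_mulr.
- apply: dvdn_trans nj _; apply/dvdnP; exists (2 * `|d'|)%N.
  by rewrite -[(2 ^ 2)%N]/4%N; lia.
- move=> l l1 l5; apply: (cong 2%N) => //.
    exact: modW (dvdn_mull _ (dvdnn _)) l1.
  exact: (modW l 8%N 4%N 5%N).
Qed.

(** * Trace and norm in a quadratic field *)

Lemma traceQ_linear (L : fieldExtType rat) (c : rat) (x y : L) :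
  traceQ (c *: x + y) = c * traceQ x + traceQ y.
Proof.
by rewrite /traceQ linearP passmx.mxof_linear linearP.
Qed.

Lemma traceQ1 (L : fieldExtType rat) : traceQ (1 : L) = (\dim {: L})%:R.
Proof.
rewrite /traceQ amull1 passmx.mxof1 ?mxtrace1 //.
exact: basis_free (vbasisP _).
Qed.

(** An off-diagonal entry of M^2 is the one of M times tr M, and it is 0. So
    if tr M <> 0 then M is triangular and c is the square of its corner. *)
Lemma mxtrace_sqrt_scalar k (M : 'M[rat]_k) (c : rat) : k = 2 ->
  M *m M = c%:M -> (forall r : rat, r ^+ 2 != c) -> \tr M = 0.
Proof.
move=> kE; subst k => MM cN.
have M00 := congr1 (fun A : 'M[rat]_2 => A 0 0) MM.
have M01 := congr1 (fun A : 'M[rat]_2 => A 0 1) MM.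
have M10 := congr1 (fun A : 'M[rat]_2 => A 1 0) MM.
move: M00 M01 M10; rewrite /mxtrace !mxE !big_ord_recl !big_ord0 !addr0 /=.
rewrite mulr1n !mulr0n.
have -> : lift ord0 ord0 = 1 :> 'I_2 by apply: val_inj.
have -> : ord0 = 0 :> 'I_2 by [].
set a := M 0 0; set b := M 0 1; set c' := M 1 0; set d := M 1 1.
move=> M00 M01 M10; apply/eqP; apply: contraT => trN0.
have b0 : b = 0 by apply: (mulIf trN0); rewrite mul0r -M01; ring.
by have := cN a; rewrite -M00 b0 mul0r addr0 expr2 eqxx.
Qed.

Section Quadratic.

Variables (L : fieldExtType rat) (iota : {rmorphism L -> algC}) (w : L) (d : int).
Hypothesis sqf : squarefree `|d|%N.
Hypothesis d_neq1 : d != 1.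
Hypothesis w2 : w ^+ 2 = d%:~R.
Hypothesis genL : <<1; w>>%VS = {: L}%VS.

Let d_gt0 : (0 < `|d|)%N := squarefree_gt0 sqf.

Lemma quad_free (u v : rat) : u%:A + v *: w = 0 -> u = 0 /\ v = 0.
Proof.
move=> E; have [v0|vN0] := eqVneq v 0.
  move: E; rewrite v0 scale0r addr0 => /eqP; rewrite scaler_eq0 oner_eq0 orbF.
  by move=> /eqP.
have wE : w = (- (u / v))%:A.
  apply: (scalerI vN0); rewrite scalerA mulrN mulrCA divff // mulr1 scaleNr.
  by apply/eqP; rewrite -addr_eq0 addrC E.
have /eqP[] := squarefree_nonsquare (- (u / v)) sqf d_neq1.
apply: (fmorph_inj (in_alg L)); rewrite rmorphXn /= -wE w2.
by rewrite alg_num_field ratr_int.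
Qed.

Lemma quad_dim : \dim {: L} = 2.
Proof.
rewrite -genL dim_Fadjoin dimv1 muln1; apply/eqP; rewrite eqn_leq; apply/andP; split.
  rewrite -ltnS -size_minPoly -(size_XnsubC (d%:~R : L) (isT : (0 < 2)%N)).
  rewrite dvdp_leq ?monic_neq0 ?monicXnsubC // minPoly_dvdp //.
    by rewrite rpredB ?polyOverXn ?polyOverC ?rpred_int.
  by rewrite rootE !hornerE w2 subrr.
rewrite ltn_neqAle eq_sym adjoin_deg_eq1 andbT; apply/negP => /vlineP[c wE].
have [|_ /eqP] := @quad_free (- c) 1; last by rewrite oner_eq0.
by rewrite scale1r wE scaleNr addNr.
Qed.

Lemma quad_coord (y : L) : exists u v : rat, y = u%:A + v *: w.
Proof.
have : y \in <<1; w>>%VS by rewrite genL memvf.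
move=> /Fadjoin1_polyP[p ->].
have : exists u v (q : {poly rat}), p = q * ('X^2 - (d%:~R)%:P) + (u%:P + v *: 'X).
  set m := 'X^2 - (d%:~R)%:P; set r := p %% m; set q := p %/ m.
  have sz : (size r <= 2)%N.
    rewrite -ltnS -(size_XnsubC (d%:~R : rat) (isT : (0 < 2)%N)).
    by rewrite ltn_modp monic_neq0 // monicXnsubC.
  exists r`_0, r`_1, q; rewrite {1}(divp_eq p m); congr (_ + _).
  apply/polyP => i; rewrite coefD coefC coefZ coefX.
  case: i => [|[|i]]; rewrite ?mulr0 ?mulr1 ?addr0 ?add0r //.
  by rewrite nth_default // (leq_trans sz).
case=> u [v [q ->]]; exists u, v.
rewrite rmorphD rmorphM rmorphB !rmorphD /= map_polyXn !map_polyC /= map_polyZ map_polyX.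
by rewrite !hornerE w2 alg_num_field ratr_int subrr mulr0 /= add0r mulr_algl.
Qed.

Lemma quad_trace (u v : rat) : traceQ (u%:A + v *: w) = 2 * u.
Proof.
rewrite traceQ_linear traceQ1 quad_dim -[v *: w]addr0 traceQ_linear.
have -> : traceQ (0 : L) = 0.
  by have := @traceQ_linear L 1 0 0; rewrite scaler0 addr0 mul1r => /eqP;
    rewrite -subr_eq0 opprD addNKr oppr_eq0 => /eqP.
have -> : traceQ w = 0.
  apply: (@mxtrace_sqrt_scalar _ _ d%:~R) quad_dim _ _ => [|r];
    last exact: squarefree_nonsquare.
  rewrite -passmx.mxof_comp ?vbasisP //.
  have -> : (amull w \o amull w = d%:~R *: \1)%VF.
    apply/lfunP => y; rewrite lfunE /= !lfunE /= lfunE /= mulrA -expr2 w2.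
    by rewrite -[RHS]mulr_algl; congr (_ * _); rewrite alg_num_field ratr_int.
  rewrite -[X in passmx.mxof _ _ X]addr0 passmx.mxof_linear.
  have /eqP -> : passmx.mxof (vbasis {: L}) (vbasis {: L}) (0 : 'End(L)) == 0.
    by rewrite passmx.mxof_eq0 ?vbasisP.
  rewrite addr0 passmx.mxof1 ?scalemx1 //.
  exact: basis_free (vbasisP _).
by rewrite mulr0 !addr0 mulrC.
Qed.

(** The element and its conjugate are both algebraic integers, and their
    product, the norm, is rational. The conjugate is obtained from an
    automorphism of algC which changes the sign of sqrt d. *)
Lemma quad_norm_int (u v : rat) : algebraic_integer (u%:A + v *: w) ->
  exists n : int, u ^+ 2 - d%:~R * v ^+ 2 = n%:~R.
Proof.
case=> p pM pr.
pose W := iota w; have W2 : W ^+ 2 = d%:~R by rewrite -rmorphXn /= w2 rmorph_int.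
pose Y := ratr u + ratr v * W; pose Y' := ratr u - ratr v * W.
have iotaY : iota (u%:A + v *: w) = Y.
  by rewrite rmorphD !rmorphZ_num rmorph1 mulr1.
have YA : Y \in Aint.
  apply: (@root_monic_Aint (map_poly intr p)).
  - rewrite -iotaY.
    have -> : map_poly (intr : int -> algC) p = map_poly iota (map_poly intr p).
      by rewrite -map_poly_comp; apply: eq_map_poly => a /=; rewrite rmorph_int.
    by rewrite fmorph_root.
  - exact: (monic_map (intr : {rmorphism int -> algC}) pM).
  - by apply/polyOverP => i; rewrite coef_map /= rpred_int.
have [x x8 x2] := sqrt_in_8 sqf.
have [nu nuW] : exists nu : {rmorphism algC -> algC}, nu W = - W.
  by apply: (sqrt_flip sqf d_neq1 W2 (inCyc_sqr _ x8)); rewrite x2.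
have Y'A : Y' \in Aint.
  have -> : Y' = nu Y by rewrite /Y' /Y rmorphD fmorph_rat rmorphM fmorph_rat /= nuW
    mulrN.
  by rewrite Aint_aut.
have YY' : Y * Y' = ratr (u ^+ 2 - d%:~R * v ^+ 2).
  rewrite rmorphB rmorphM !rmorphXn /= ratr_int -W2 /Y /Y'; ring.
have /intrP[n nE] : Y * Y' \in Num.int.
  by apply: Cint_rat_Aint; [rewrite YY' Crat_rat|rewrite rpredM].
exists n; apply: (fmorph_inj (ratr : {rmorphism rat -> algC})).
by rewrite [LHS]/= -YY' nE rmorph_int.
Qed.

End Quadratic.

(** * The discriminant of a quadratic field *)

Lemma det_mx22E (M : 'M[rat]_2) : \det M = M 0 0 * M 1 1 - M 0 1 * M 1 0.
Proof.
rewrite (expand_det_row _ 0) !big_ord_recl big_ord0 addr0 /cofactor !det_mx11 !mxE.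
rewrite /= expr0 expr1 mul1r mulN1r mulrN.
by congr (M _ _ * M _ _ - M _ _ * M _ _); apply: val_inj.
Qed.

Section QuadraticDiscriminant.

Variables (L : fieldExtType rat) (iota : {rmorphism L -> algC}) (w : L) (d : int).
Hypothesis sqf : squarefree `|d|%N.
Hypothesis d_neq1 : d != 1.
Hypothesis w2 : w ^+ 2 = d%:~R.
Hypothesis genL : <<1; w>>%VS = {: L}%VS.

Let quad (u v : rat) : L := u%:A + v *: w.

Let al : {rmorphism rat -> L} := GRing.in_alg L.

Lemma quadE u v : quad u v = al u + al v * w.
Proof. by rewrite /quad -(mulr_algl v w). Qed.

Lemma al_int c : al c%:~R = c%:~R.
Proof. exact: rmorph_int. Qed.

Lemma quadM u v u' v' :
  quad u v * quad u' v' = quad (u * u' + d%:~R * v * v') (u * v' + v * u').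
Proof. rewrite !quadE !rmorphD !rmorphM al_int -w2; ring. Qed.

Lemma quad_inj u v u' v' : quad u v = quad u' v' -> u = u' /\ v = v'.
Proof.
move=> /eqP; rewrite -subr_eq0 => /eqP E.
have [|/eqP] := @quad_free L w d sqf d_neq1 w2 (u - u') (v - v').
  by rewrite -E /quad !scalerBl opprD addrACA.
by rewrite subr_eq0 => /eqP-> /eqP; rewrite subr_eq0 => /eqP->.
Qed.

Lemma quad_trace_form (u1 v1 u2 v2 : rat) :
  traceQ (quad u1 v1 * quad u2 v2) = 2 * (u1 * u2 + d%:~R * v1 * v2).
Proof. by rewrite quadM /quad (quad_trace sqf d_neq1 w2 genL). Qed.

Lemma quad_comb u1 v1 u2 v2 (c1 c2 : int) :
  quad u1 v1 *~ c1 + quad u2 v2 *~ c2 =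
  quad (c1%:~R * u1 + c2%:~R * u2) (c1%:~R * v1 + c2%:~R * v2).
Proof.
rewrite !quadE !rmorphD !rmorphM !al_int -!(mulrzl (_ + _)); ring.
Qed.

Lemma quad_integral (u v : rat) (t n : int) :
  2 * u = t%:~R -> u ^+ 2 - d%:~R * v ^+ 2 = n%:~R ->
  algebraic_integer (quad u v).
Proof.
move=> tE nE; pose p : {poly int} := 'X^2 + (- t *: 'X + n%:P).
have pM : p \is monic.
  rewrite monicE lead_coefDl ?lead_coefXn // size_polyXn.
  rewrite (leq_ltn_trans (size_polyD _ _)) // gtn_max.
  by rewrite (leq_ltn_trans (size_scale_leq _ _)) ?size_polyX // (leq_ltn_trans
    (size_polyC_leq1 _)).
exists p => //; rewrite rootE /p !rmorphD /= map_polyZ map_polyXn map_polyX map_polyC.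
rewrite !hornerE /= mulrNz -!al_int -tE -nE !quadE; apply/eqP.
rewrite !(rmorphB, rmorphM, rmorphXn) al_int -w2 rmorph_nat; ring.
Qed.

(** Stickelberger's congruence in disguise: when the three norms on the right
    are integers, this number is s^2 - 4 t with s and t integers, hence 0 or 1
    modulo 4. *)
Lemma quad_disc_norm_form (u1 v1 u2 v2 : rat) :
  4 * d%:~R * (u1 * v2 - u2 * v1) ^+ 2 =
  (((u1 + u2) ^+ 2 - d%:~R * (v1 + v2) ^+ 2) - (u1 ^+ 2 - d%:~R * v1 ^+ 2)
    - (u2 ^+ 2 - d%:~R * v2 ^+ 2)) ^+ 2
  - 4 * (u1 ^+ 2 - d%:~R * v1 ^+ 2) * (u2 ^+ 2 - d%:~R * v2 ^+ 2) :> rat.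
Proof. ring. Qed.

(** Let delta be the determinant of the coordinates of the basis b on 1, w;
    the trace form of b has determinant 4 d delta^2. The integers 1 and w, or
    1 and (1 + w)/2 if d is 1 modulo 4, have integer coordinates on b, so that
    kappa delta is 1, or 1/2, for some integer kappa: D kappa^2 is 4 d, or d.
    As d is squarefree, kappa is 1 or 2 up to sign, and 2 would contradict
    Stickelberger's congruence. The length k of the basis is a variable, since
    the dimension of L is only provably equal to 2. *)
Lemma quad_discriminant_tuple k (b : k.-tuple L) (D : int) : k = 2 ->
    (forall i : 'I_k, algebraic_integer (tnth b i)) ->
    (forall x : L, algebraic_integer x ->
       exists c : 'I_k -> int, x = \sum_i tnth b i *~ c i) ->
    D%:~R = \det (\matrix_(i, j) traceQ (tnth b i * tnth b j)) ->
  D = quad_disc d.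
Proof.
move=> kE; subst k => bint bspan DE.
have [u1 [v1 b1E]] := quad_coord w2 genL (tnth b 0).
have [u2 [v2 b2E]] := quad_coord w2 genL (tnth b 1).
pose delta := u1 * v2 - u2 * v1.
have {}DE : D%:~R = 4 * d%:~R * delta ^+ 2.
  by rewrite DE det_mx22E !mxE b1E b2E !quad_trace_form /delta; ring.
have comb (x : L) : algebraic_integer x -> exists c1 c2 : int,
    x = quad (c1%:~R * u1 + c2%:~R * u2) (c1%:~R * v1 + c2%:~R * v2).
  move=> /bspan[c xE]; exists (c 0), (c 1).
  rewrite -quad_comb xE big_ord_recl big_ord1 b1E.
  by have -> : lift ord0 ord0 = 1 :> 'I_2; [apply: val_inj|rewrite b2E].
have kappaE (x y : rat) (c1 c2 e1 e2 : int) :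
    quad x y = quad (e1%:~R * u1 + e2%:~R * u2) (e1%:~R * v1 + e2%:~R * v2) ->
    quad 1 0 = quad (c1%:~R * u1 + c2%:~R * u2) (c1%:~R * v1 + c2%:~R * v2) ->
  exists kappa : int, kappa%:~R * delta = y.
  move=> /quad_inj[_ ->] /quad_inj[E1 E2]; exists (c1 * e2 - c2 * e1).
  rewrite rmorphB !rmorphM /= /delta.
  transitivity ((c1%:~R * u1 + c2%:~R * u2) * (e1%:~R * v1 + e2%:~R * v2) -
    (c1%:~R * v1 + c2%:~R * v2) * (e1%:~R * u1 + e2%:~R * u2)); first by ring.
  by rewrite -E1 -E2; ring.
have [c1 [c2 cE]] : exists c1 c2 : int,
    quad 1 0 = quad (c1%:~R * u1 + c2%:~R * u2) (c1%:~R * v1 + c2%:~R * v2).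
  by apply/comb/(quad_integral (t := 2) (n := 1)); rewrite ?mulr1 //; ring.
have d4 : (d %% 4)%Z <> 0 by move=> d0; have := @sqf 2%N isT; lia.
rewrite /quad_disc; case: eqP => [d1|d_n1].
  have [e1 [e2 eE]] : exists e1 e2 : int, quad (1 / 2) (1 / 2) =
      quad (e1%:~R * u1 + e2%:~R * u2) (e1%:~R * v1 + e2%:~R * v2).
    apply/comb/(quad_integral (t := 1) (n := - (d %/ 4)%Z)).
      by rewrite mulrC divfK.
    have {1}-> : d = (d %/ 4)%Z * 4 + 1 by lia.
    by rewrite !(rmorphD, rmorphM, rmorphN) /=; field.
  have [kappa kE] := kappaE _ _ _ _ _ _ eE cE.
  have DkE : D * kappa ^+ 2 = d.
    apply: (@intr_inj rat); rewrite rmorphM rmorphXn /= DE.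
    transitivity (4 * d%:~R * (kappa%:~R * delta) ^+ 2 : rat); first by ring.
    by rewrite kE; field.
  suff k1 : `|kappa|%N = 1%N.
    by rewrite -DkE; have -> : kappa ^+ 2 = 1; [lia|rewrite mulr1].
  apply/eqP; rewrite -dvdn1; apply: squarefree_prime_dvd.
    by apply: squarefree_dvd sqf; rewrite -DkE abszM abszX dvdn_mull // dvdn_exp.
  move=> p p_pr pk; have := @sqf p p_pr.
  by rewrite -DkE abszM abszX dvdn_mull // dvdn_exp2r.
have [e1 [e2 eE]] : exists e1 e2 : int, quad 0 1 =
    quad (e1%:~R * u1 + e2%:~R * u2) (e1%:~R * v1 + e2%:~R * v2).
  apply/comb/(quad_integral (t := 0) (n := - d)); rewrite ?mulr0 //.
  by rewrite rmorphN /=; ring.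
have [kappa kE] := kappaE _ _ _ _ _ _ eE cE.
have DkE : D * kappa ^+ 2 = 4 * d.
  apply: (@intr_inj rat); rewrite rmorphM rmorphXn rmorphM /= DE.
  transitivity (4 * d%:~R * (kappa%:~R * delta) ^+ 2 : rat); first by ring.
  by rewrite kE; ring.
have k2 : (`|kappa| %| 2)%N.
  have DkA : (`|D| * `|kappa| ^ 2 = 4 * `|d|)%N by rewrite -abszX -abszM DkE abszM.
  have k_dvd p : prime p -> (p %| `|kappa|)%N -> p = 2%N.
    move=> p_pr pk; apply/eqP; apply: contraT => pn2.
    have := @sqf p p_pr; rewrite -(@Gauss_dvdr _ 4).
      by rewrite -DkA dvdn_mull // dvdn_exp2r.
    by rewrite coprimeXl // -[4%N]/(2 ^ 2)%N coprimeXr // prime_coprime // dvdn_prime2.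
  apply: squarefree_prime_dvd => p p_pr; last by move=> /(k_dvd p p_pr) ->.
  apply/negP => p2k.
  have p2 : p = 2%N by apply: k_dvd => //; apply: dvdn_trans p2k; apply: dvdn_exp.
  have := @sqf 2%N isT; rewrite -(@dvdn_pmul2l 4) // -DkA dvdn_mull //.
  by rewrite p2 in p2k; apply: (@dvdn_exp2r _ _ 2%N p2k).
have [k1|k4] : kappa ^+ 2 = 1 \/ kappa ^+ 2 = 4.
  have le2 : (`|kappa| <= 2)%N by apply: dvdn_leq.
  have n0 : `|kappa|%N <> 0%N by move=> k0; rewrite k0 in k2.
  have : kappa = 1 \/ kappa = -1 \/ kappa = 2 \/ kappa = -2 by lia.
  by case=> [->|[->|[->|->]]]; [left|left|right|right].
  by rewrite -DkE k1 mulr1.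
have DdE : D = d by move: DkE; rewrite k4; lia.
have bsum : algebraic_integer (quad (u1 + u2) (v1 + v2)).
  have -> : quad (u1 + u2) (v1 + v2) = tnth b 0 + tnth b 1.
    by rewrite b1E b2E /quad !scalerDl addrACA.
  by apply: (@integral_add _ _ (intr : {rmorphism int -> L})); apply: bint.
have [n3 n3E] := quad_norm_int iota sqf d_neq1 w2 bsum.
have bint1 := bint 0; have bint2 := bint 1.
rewrite b1E in bint1; rewrite b2E in bint2.
have [n1 n1E] := quad_norm_int iota sqf d_neq1 w2 bint1.
have [n2 n2E] := quad_norm_int iota sqf d_neq1 w2 bint2.
have : D = (n3 - n1 - n2) ^+ 2 - 4 * n1 * n2.
  apply: (@intr_inj rat); rewrite DE quad_disc_norm_form n1E n2E n3E.
  by rewrite !(rmorphB, rmorphM, rmorphXn).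
set s := n3 - n1 - n2; rewrite DdE -mulrA; set t := n1 * n2 => dE.
have [h|h] : (exists r, s = 2 * r) \/ (exists r, s = 2 * r + 1).
  have [h|h] : (s %% 2)%Z = 0 \/ (s %% 2)%Z = 1 by lia.
    by left; exists (s %/ 2)%Z; lia.
  by right; exists (s %/ 2)%Z; lia.
- case: h => r sE; case: d4.
  have -> : d = 4 * (r ^+ 2 - t) by rewrite dE sE; ring.
  by lia.
- case: h => r sE; case: d_n1.
  have -> : d = 4 * (r ^+ 2 + r - t) + 1 by rewrite dE sE; ring.
  by lia.
Qed.

End QuadraticDiscriminant.

Lemma squarefree_decomp (m : nat) : (0 < m)%N ->
  exists k f : nat, [/\ (0 < f)%N, squarefree k & m = (k * f ^ 2)%N].
Proof.
elim/ltn_ind: m => m IH m_gt0; have [sqf|] := pselect (squarefree m).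
  by exists m, 1%N; rewrite muln1.
move=> /existsNP[p /not_implyP[p_pr /negP]]; rewrite negbK => /dvdnP[j mE].
have j_gt0 : (0 < j)%N by move: m_gt0; rewrite mE muln_gt0 => /andP[].
have [|//|k [f [f_gt0 sqf jE]]] := IH j.
  by rewrite mE ltn_Pmulr // -(expn0 p) ltn_exp2l // prime_gt1.
exists k, (f * p)%N; split=> //; first by rewrite muln_gt0 f_gt0 prime_gt0.
by rewrite mE jE expnMn mulnA.
Qed.

Lemma squarefree_decompz (a : int) : a != 0 ->
  exists (d : int) (f : nat), [/\ (0 < f)%N, squarefree `|d|%N & a = d * f%:Z ^+ 2].
Proof.
move=> aN0; have [|k [f [f_gt0 sqf aE]]] := @squarefree_decomp `|a|%N.
  by rewrite absz_gt0.
have aE' : `|a|%N%:Z = k%:Z * f%:Z ^+ 2 by rewrite aE PoszM -rmorphXn.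
have [a_pos|a_neg] : a = `|a|%N%:Z \/ a = - `|a|%N%:Z by lia.
  by exists k%:Z, f; split=> //; rewrite -aE'.
by exists (- k%:Z), f; split; rewrite ?abszN // mulNr -aE'.
Qed.

Lemma is_discriminant_sqrt (a d D : int) (f : nat) : (0 < f)%N ->
    squarefree `|d|%N -> d != 1 -> a = d * f%:Z ^+ 2 ->
  is_discriminant (Qadj [:: sqrtC (a%:~R : algC)]) D -> D = quad_disc d.
Proof.
move=> f_gt0 sqf d_neq1 aE; rewrite /Qadj.
case: num_field_exists => L [iota [s1 s1E gen]] /=.
case: s1 s1E gen => [|x [|? ?]] //= [xE] gen.
have fN0 : (f%:R : L) != 0 by rewrite -(fmorph_eq0 iota) rmorph_nat pnatr_eq0 -lt0n.
have x2 : x ^+ 2 = a%:~R.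
  by apply: (fmorph_inj iota); rewrite rmorphXn /= xE sqrtCK rmorph_int.
pose w := x / f%:R.
have w2 : w ^+ 2 = d%:~R.
  by rewrite expr_div_n x2 aE rmorphM rmorphXn /= mulfK // expf_neq0.
have genL : <<1; w>>%VS = {: L}%VS.
  apply/eqP; rewrite eqEsubv subvf /= -gen adjoin_seq1.
  apply/FadjoinP; split; first exact: sub1v.
  have -> : x = w * f%:R by rewrite /w divfK.
  by rewrite memvM ?memv_adjoin // rpred_nat.
case=> b [_ bint bspan] DE.
have dim2 := quad_dim sqf d_neq1 w2 genL.
exact: (quad_discriminant_tuple iota sqf d_neq1 w2 genL dim2 bint bspan DE).
Qed.

(** * The index of a in its n-th roots: general bounds *)

Lemma inCyc_rootM n m (x w : algC) : (m %| n)%N -> (0 < m)%N -> x ^+ m = 1 ->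
  inCyc n (x * w) <-> inCyc n w.
Proof.
move=> mn m_gt0 xm.
have rootn u : u ^+ m = 1 -> (0 < n)%N -> inCyc n u.
  by move=> um n_gt0; apply: inCyc_root => //; case/dvdnP: mn => j ->;
    rewrite mulnC exprM um expr1n.
split=> [xw|wn]; last by apply: inCycM => //; apply: rootn => //; apply: inCyc_gt0 wn.
have -> : w = x ^+ m.-1 * (x * w).
  by rewrite mulrA -exprSr prednK // xm mul1r.
apply: inCycM (xw); apply: rootn; last exact: inCyc_gt0 xw.
by rewrite -exprM mulnC exprM xm expr1n.
Qed.

Lemma inCyc_intM n (c : int) (w : algC) : c != 0 ->
  inCyc n (c%:~R * w) <-> inCyc n w.
Proof.
move=> cN0; split=> [cw|wn]; last first.
  by apply: inCycM => //; apply: inCyc_int; apply: inCyc_gt0 wn.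
have -> : w = ratr c%:~R^-1 * (c%:~R * w).
  by rewrite fmorphV /= ratr_int mulKf // intr_eq0.
by apply: inCycM (cw); apply: inCyc_rat; apply: inCyc_gt0 cw.
Qed.

Lemma inCyc_sqrE n (u w : algC) : u ^+ 2 = w ^+ 2 -> inCyc n u <-> inCyc n w.
Proof. by move=> uw; split; apply: inCyc_sqr; rewrite uw. Qed.

Lemma sqrt_squareM_cyclotomicP (a d : int) (f n : nat) (r : algC) :
    (0 < f)%N -> squarefree `|d|%N -> a = d * f%:Z ^+ 2 -> r ^+ 2 = a%:~R ->
  (0 < n)%N -> inCyc n r <-> (`|quad_disc d| %| n)%N.
Proof.
move=> f_gt0 sqf aE r2 n_gt0.
have fN0 : (f%:R : algC) != 0 by rewrite pnatr_eq0 -lt0n.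
rewrite -(@sqrt_cyclotomicP d n (r / f%:R)) //; last first.
  by rewrite expr_div_n r2 aE rmorphM rmorphXn /= mulfK // expf_neq0.
have {1}-> : r = f%:Z%:~R * (r / f%:R) by rewrite mulrCA divff // mulr1.
by apply: inCyc_intM; rewrite -lt0n in f_gt0 *.
Qed.

Section KummerIndex.

Variables (a : int) (n : nat) (alpha : algC).
Hypothesis n_gt0 : (0 < n)%N.
Hypothesis a_neq0 : a != 0.
Hypothesis alphan : alpha ^+ n = a%:~R.

(** The power alpha^(n/j) is a j-th root of a; t collects the j for which
    some j-th root of a is cyclotomic, and these j divide the factor by which
    the degree of alpha over Q(z) falls short of n. *)
Lemma kummer_index z : n.-primitive_root z -> exists t : nat,
  [/\ (t %| n)%N, degQ [:: z; alpha] = (totient n * (n %/ t))%N &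
      forall j, (j %| n)%N -> inCyc n (alpha ^+ (n %/ j)) <-> (j %| t)%N].
Proof.
move=> zP; have [m [m_gt0 degE inE]] := degQ_radical zP a_neq0 alphan.
have mn : (m %| n)%N by apply/inE; rewrite alphan; apply: inQ_int.
have t_gt0 : (0 < n %/ m)%N by rewrite divn_gt0 // dvdn_leq.
exists (n %/ m)%N; split.
- exact: dvdn_div.
- by rewrite divnA // mulKn.
move=> j jn; have j_gt0 : (0 < j)%N by apply: dvdn_gt0 jn.
by rewrite (inCycP _ zP) inE (dvdn_divRL _ jn) (dvdn_divRL _ mn) mulnC.
Qed.

(** If y = alpha^(n/t) is cyclotomic then |y|^2, which is |a|^(2/t), is an
    integer; the maximality of e makes t divide 2 e. *)
Lemma kummer_index_dvd e t : (0 < `|a|)%N -> is_max_exponent e `|a|%N -> (t %| n)%N ->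
  inCyc n (alpha ^+ (n %/ t)) -> (t %| 2 * e)%N.
Proof.
move=> a_gt0 emax tn [z zP zy].
have t_gt0 : (0 < t)%N by apply: dvdn_gt0 tn.
have [|c cn] := radical_norm_rational (b := a ^+ (n %/ t)) zP zy.
  by rewrite exprAC alphan rmorphXn.
have : (c ^ n = `|a| ^ (n %/ t * 2))%N by rewrite cn abszX expnM.
move=> /(max_exponent_power_dvd a_gt0 emax n_gt0).
by rewrite -{1}(divnK tn) -mulnA dvdn_pmul2l // divn_gt0 // dvdn_leq.
Qed.

End KummerIndex.

(** * The index of a in its n-th roots: a is a power of a0 *)

Lemma even_quotient_gcd n e : (0 < n)%N -> (0 < e)%N -> (2 * gcdn n e %| n)%N ->
  odd (e %/ gcdn n e) /\ (2 ^ (logn 2 e).+1 %| n)%N.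
Proof.
move=> n_gt0 e_gt0 gn; set g := gcdn n e in gn *.
have g_gt0 : (0 < g)%N by rewrite gcdn_gt0 n_gt0.
have s_lt : (logn 2 g < logn 2 n)%N.
  by have := dvdn_leq_log 2 n_gt0 gn; rewrite lognM // logn_prime.
have lg : logn 2 g = logn 2 e.
  by move: s_lt; rewrite /g logn_gcd // gtn_min ltnn /= => /ltnW/minn_idPr.
split; last by rewrite pfactor_dvdn // -lg.
rewrite -[odd _]negbK -dvdn2 (pfactor_dvdn 1) //; last first.
  by rewrite divn_gt0 // dvdn_leq // dvdn_gcdr.
by rewrite logn_div ?dvdn_gcdr // -/g lg subnn.
Qed.

Lemma even_quotient_gcdV n e : (0 < n)%N -> (0 < e)%N ->
  (2 ^ (logn 2 e).+1 %| n)%N -> (2 * gcdn n e %| n)%N.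
Proof.
move=> n_gt0 e_gt0 vn; have g_gt0 : (0 < gcdn n e)%N by rewrite gcdn_gt0 n_gt0.
rewrite -dvdn_divRL ?dvdn_gcdl // -[2%N]/(2 ^ 1)%N pfactor_dvdn //; last first.
  by rewrite divn_gt0 // dvdn_leq // dvdn_gcdl.
rewrite logn_div ?dvdn_gcdl // logn_gcd // subn_gt0 gtn_min ltnn /=.
by rewrite -pfactor_dvdn.
Qed.

Section KummerCases.

Variables (a a0 d : int) (e f n : nat) (alpha : algC).
Hypothesis n_gt0 : (0 < n)%N.
Hypothesis a_neq0 : a != 0.
Hypothesis emax : is_max_exponent e `|a|%N.
Hypothesis f_gt0 : (0 < f)%N.
Hypothesis sqf : squarefree `|d|%N.
Hypothesis a0E : a0 = d * f%:Z ^+ 2.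
Hypothesis alphan : alpha ^+ n = a%:~R.

Let e_gt0 : (0 < e)%N. Proof. by case: emax. Qed.
Let a_gt0 : (0 < `|a|)%N. Proof. by rewrite absz_gt0. Qed.

Lemma a0_neq0 : a0 != 0.
Proof.
rewrite a0E mulf_neq0 //; first by rewrite -absz_gt0 squarefree_gt0.
by rewrite expf_neq0 // -absz_gt0.
Qed.

(** With g = gcd(n, e), the power alpha^(n/g) is a0^(e/g) times a g-th root of
    unity, so g divides t. As t divides gcd(n, 2 e) it is g or 2 g, and it is
    2 g when 2 g divides n and the square root of a0^(e/g) is cyclotomic. Now
    2 g divides n only if 2^(v+1) does, v being the valuation of e at 2, and
    then e/g is odd, so the square root in question is that of a0. *)
Lemma kummer_index_perfect : a = a0 ^+ e -> forall t, (t %| n)%N ->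
    (forall j, (j %| n)%N -> inCyc n (alpha ^+ (n %/ j)) <-> (j %| t)%N) ->
  t = (gcdn n e *
       (if (2 ^ (logn 2 e).+1 %| n) && (`|quad_disc d| %| n) then 2 else 1))%N.
Proof.
move=> aE t tn tP; set g := gcdn n e.
have g_gt0 : (0 < g)%N by rewrite gcdn_gt0 n_gt0.
have gn : (g %| n)%N := dvdn_gcdl n e.
have ge : (g %| e)%N := dvdn_gcdr n e.
have a0gN0 : (a0 ^+ (e %/ g))%:~R != 0 :> algC by rewrite intr_eq0 expf_neq0 // a0_neq0.
pose omega : algC := alpha ^+ (n %/ g) / (a0 ^+ (e %/ g))%:~R.
have omegag : omega ^+ g = 1.
  rewrite expr_div_n -exprM divnK // alphan -rmorphXn /= -exprM divnK // -aE.
  by rewrite divff // intr_eq0.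
have yE : alpha ^+ (n %/ g) = (a0 ^+ (e %/ g))%:~R * omega.
  by rewrite mulrC divfK.
have gt : (g %| t)%N.
  apply/tP => //; rewrite yE; apply/inCyc_intM; first by rewrite expf_neq0 ?a0_neq0.
  by rewrite -[omega]mulr1; apply/(inCyc_rootM _ gn g_gt0 omegag)/(@inCyc_int n 1).
have t2e : (t %| 2 * e)%N.
  by apply: (kummer_index_dvd n_gt0 alphan a_gt0 emax tn); apply/tP.
have t2g : (t %| 2 * g)%N.
  by rewrite /g muln_gcdr dvdn_gcd t2e andbT; apply: dvdn_mull.
have /dvdnP[j tE] := gt.
have j2 : (j %| 2)%N by rewrite -(@dvdn_pmul2r g) // -tE.
have {j2} jE : j = (if (2 * g %| t)%N then 2 else 1)%N.
  rewrite tE dvdn_pmul2r //.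
  by case: j j2 {tE} => [|[|[|j]]] // /dvdn_leq.
rewrite tE mulnC {}jE; congr (_ * (if _ then _ else _))%N.
have core : (2 * g %| n)%N -> odd (e %/ g) ->
    inCyc n (alpha ^+ (n %/ (2 * g))) <-> (`|quad_disc d| %| n)%N.
  move=> gn2 odd_eg; pose eta := sqrtC omega; pose r : algC := sqrtC a0%:~R.
  have eta2 : eta ^+ 2 = omega by rewrite sqrtCK.
  have r2 : r ^+ 2 = a0%:~R by rewrite sqrtCK.
  rewrite -(sqrt_squareM_cyclotomicP f_gt0 sqf a0E r2 n_gt0).
  rewrite -(@inCyc_rootM n (2 * g) eta r) ?muln_gt0 //; last first.
    by rewrite exprM eta2.
  rewrite -(@inCyc_intM n (a0 ^+ (e %/ g)./2) (eta * r)) ?expf_neq0 ?a0_neq0 //.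
  have hn : (n %/ (2 * g) * 2 = n %/ g)%N.
    by rewrite [(2 * g)%N]mulnC divnMA divnK // dvdn_divRL.
  apply: inCyc_sqrE; rewrite !exprMn eta2 r2 -exprM hn yE.
  have egE : (e %/ g = ((e %/ g)./2 * 2).+1)%N.
    by rewrite -{1}(odd_double_half (e %/ g)) odd_eg -muln2.
  rewrite {1}egE; set h := (e %/ g)./2.
  have -> : a0 ^+ (h * 2).+1 = a0 * (a0 ^+ h) ^+ 2 by rewrite exprS exprM.
  by rewrite rmorphM (rmorphXn _ 2) /=; ring.
apply/idP/andP => [gt2|[vn Dn]].
  have gn2 : (2 * g %| n)%N by apply: dvdn_trans gt2 tn.
  have [odd_eg vn] := even_quotient_gcd n_gt0 e_gt0 gn2.
  by split=> //; apply/core => //; apply/tP.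
have gn2 := even_quotient_gcdV n_gt0 e_gt0 vn.
have [odd_eg _] := even_quotient_gcd n_gt0 e_gt0 gn2.
by apply/tP => //; apply/core.
Qed.

(** Such an automorphism maps a primitive (2n)-th root of unity z to -z, so
    only the even part of a polynomial expression in z survives, and that is
    an expression in z^2, a primitive n-th root of unity. *)
Lemma cyclotomic_half_fixed (nu : {rmorphism algC -> algC}) (w : algC) :
    ~~ odd n -> (forall x, x ^+ (2 * n) = 1 -> nu x = x ^+ n.+1) ->
    inCyc (2 * n) w -> nu w = w -> inCyc n w.
Proof.
move=> n_even nuP [z zP [p wE]] nuw.
have zn : z ^+ n = -1.
  have : (z ^+ n) ^+ 2 == 1 by rewrite -exprM mulnC prim_expr_order.
  rewrite sqrf_eq1 => /orP[|/eqP//].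
  by rewrite -(prim_order_dvd zP) gtnNdvd // mul2n -addnn -{1}(addn0 n) ltn_add2l.
have nuz : nu z = - z by rewrite nuP ?(prim_expr_order zP) // exprS zn mulrN1.
have z2P : n.-primitive_root (z ^+ 2).
  have := dvdn_prim_root zP (dvdn_mull 2 (dvdnn n)).
  by rewrite mulnK.
pose ev := (map_poly ratr (even_poly p)).[z ^+ 2] : algC.
pose od := (map_poly ratr (odd_poly p)).[z ^+ 2] : algC.
have wEO : w = ev + od * z.
  rewrite wE -{1}[p]poly_even_odd rmorphD rmorphM /= !map_comp_poly.
  by rewrite map_polyX rmorphXn /= map_polyX !hornerE !horner_comp !hornerE.
have nu_fix (q : {poly rat}) : nu (map_poly ratr q).[z ^+ 2] = (map_poly ratr q).[z ^+
  2] :> algC.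
  by rewrite aut_horner_rat rmorphXn /= nuz sqrrN.
have : w = ev - od * z.
  by rewrite -nuw wEO rmorphD rmorphM /= !nu_fix nuz mulrN.
rewrite {1}wEO => /addrI/eqP; rewrite -subr_eq0 opprK -mulr2n mulrn_eq0 /= => /eqP od0.
by exists (z ^+ 2) => //; rewrite wEO od0 addr0; exists (even_poly p).
Qed.

End KummerCases.

(** * The index of a in its n-th roots: a negative and e even *)

Lemma quad_disc_shape (d : int) : squarefree `|d|%N -> exists j m : nat,
  [/\ `|quad_disc d|%N = (2 ^ j * m)%N, odd m, squarefree m &
      [|| j == 0, j == 2 | j == 3]%N].
Proof.
move=> sqf; have d4 : (d %% 4)%Z <> 0 by move=> d0; have := sqf 2%N isT; lia.
rewrite /quad_disc; case: eqP => [d1|d_n1].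
  by exists 0%N, `|d|%N; split=> //; [rewrite mul1n|lia].
have [d3|d2] : (d %% 4)%Z = 3 \/ (d %% 4)%Z = 2 by lia.
  by exists 2%N, `|d|%N; split=> //; [rewrite abszM|lia].
exists 3%N, `|d|./2; have dE : `|d|%N = (2 * `|d|./2)%N by lia.
split=> //; [by rewrite abszM; lia|by lia|].
by apply: squarefree_dvd sqf; rewrite [X in (_ %| X)%N]dE dvdn_mull.
Qed.

Section KummerTwisted.

Variables (a a0 d : int) (e f n : nat) (alpha : algC).
Hypothesis n_gt0 : (0 < n)%N.
Hypothesis a_neq0 : a != 0.
Hypothesis emax : is_max_exponent e `|a|%N.
Hypothesis f_gt0 : (0 < f)%N.
Hypothesis sqf : squarefree `|d|%N.
Hypothesis a0E : a0 = d * f%:Z ^+ 2.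
Hypothesis alphan : alpha ^+ n = a%:~R.
Hypothesis aE : a = - (- a0) ^+ e.
Hypothesis e_even : ~~ odd e.

Let e_gt0 : (0 < e)%N. Proof. by case: emax. Qed.
Let a_gt0 : (0 < `|a|)%N. Proof. by rewrite absz_gt0. Qed.
Let b := - a0.
Let b_neq0 : b != 0. Proof. by rewrite oppr_eq0 (a0_neq0 f_gt0 sqf a0E). Qed.

(** For n odd the sign is absorbed in the power: g = gcd(n, e) is odd and
    a = (- b^(e/g))^g. As t is odd and divides 2 e, it divides e. *)
Lemma kummer_index_twisted_odd : odd n -> forall t, (t %| n)%N ->
    (forall j, (j %| n)%N -> inCyc n (alpha ^+ (n %/ j)) <-> (j %| t)%N) ->
  t = gcdn n e.
Proof.
move=> n_odd t tn tP; set g := gcdn n e.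
have g_gt0 : (0 < g)%N by rewrite gcdn_gt0 n_gt0.
have gn : (g %| n)%N := dvdn_gcdl n e.
have ge : (g %| e)%N := dvdn_gcdr n e.
have g_odd : odd g by apply: contraLR n_odd; rewrite -!dvdn2 => g2; apply: dvdn_trans gn.
pose c : int := - b ^+ (e %/ g).
have cN0 : c != 0 by rewrite oppr_eq0 expf_neq0.
have cg : c ^+ g = a.
  by rewrite aE exprNn -signr_odd g_odd expr1 -exprM divnK // mulN1r.
pose omega : algC := alpha ^+ (n %/ g) / c%:~R.
have omegag : omega ^+ g = 1.
  by rewrite expr_div_n -exprM divnK // alphan -(rmorphXn intr) /= cg divff // intr_eq0.
have yE : alpha ^+ (n %/ g) = c%:~R * omega by rewrite mulrC divfK // intr_eq0.
have gt : (g %| t)%N.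
  apply/tP => //; rewrite yE; apply/inCyc_intM => //.
  by rewrite -[omega]mulr1; apply/(inCyc_rootM _ gn g_gt0 omegag)/(@inCyc_int n 1).
have t2e : (t %| 2 * e)%N.
  by apply: (kummer_index_dvd n_gt0 alphan a_gt0 emax tn); apply/tP.
apply/eqP; rewrite eqn_dvd gt andbT dvdn_gcd tn.
have t_odd : odd t by apply: contraLR n_odd; rewrite -!dvdn2 => t2; apply: dvdn_trans tn.
by rewrite -(@Gauss_dvdr _ 2) // coprimen2.
Qed.

(** An h-th root of a = - b^e involves an h-th root omega of -1, which is a
    (2h)-th root of unity; this is why h = gcd(n/2, e) replaces gcd(n, e). As
    before t is h or 2 h, and it is 2 h when Y = alpha^(n/2h), whose square is
    b^(e/h) omega, is cyclotomic. Let eta be a square root of omega.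
    If n/(2h) is even, that is if 2^(v+2) divides n, then eta and i are in
    Q(zeta_n) and e/h is odd: the question is whether sqrt b is there, or
    equivalently sqrt (- b) = sqrt a0. If n/(2h) is odd, then the automorphism
    zeta |-> zeta^(n+1) of the (2n)-th roots of unity, which is trivial on
    Q(zeta_n), changes the sign of eta. So Y can only be cyclotomic if e/h is
    odd and this automorphism also changes the sign of sqrt b, which has to lie
    in Q(zeta_2n) but not in Q(zeta_n): the discriminant divides 2 n and not
    n. Since its valuation at 2 is 0, 2 or 3, this requires v = 1, n exactly
    divisible by 4, and a discriminant divisible by 8. *)
Lemma kummer_index_twisted_even : ~~ odd n -> forall t, (t %| n)%N ->
    (forall j, (j %| n)%N -> inCyc n (alpha ^+ (n %/ j)) <-> (j %| t)%N) ->
  t = (gcdn n./2 e *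
       (if (`|quad_disc d| %| 8 * n) && ((2 ^ (logn 2 e + 2) %| n) ||
           [&& logn 2 e == 1, 8 %| `|quad_disc d|, 4 %| n & ~~ (8 %| n)])
        then 2 else 1))%N.
Proof.
move=> n_even t tn tP; set h := gcdn _ _; set C := _ && _.
have nE : n = (2 * n./2)%N by rewrite mul2n -[LHS]odd_double_half (negPf n_even).
have n2_gt0 : (0 < n./2)%N by move: n_gt0; rewrite {1}nE muln_gt0 => /andP[].
have h_gt0 : (0 < h)%N by rewrite gcdn_gt0 n2_gt0.
have h2n : (2 * h %| n)%N by rewrite [X in (_ %| X)%N]nE dvdn_pmul2l // dvdn_gcdl.
have hn : (h %| n)%N by apply: dvdn_trans h2n; apply: dvdn_mull.
have he : (h %| e)%N := dvdn_gcdr _ _.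
have v_gt0 : (0 < logn 2 e)%N by rewrite logn_gt0 mem_primes e_gt0 dvdn2.
have sE : logn 2 n = (logn 2 n./2).+1 by rewrite {1}nE lognM // logn_prime.
have lh : logn 2 h = minn (logn 2 n./2) (logn 2 e) by rewrite logn_gcd.
have odd_logn k : (0 < k)%N -> odd k = (logn 2 k == 0)%N.
  move=> k_gt0; have := pfactor_dvdn 1 (isT : prime 2) k_gt0.
  by rewrite expn1 dvdn2 => /(congr1 negb); rewrite negbK -eqn0Ngt.
have eh_gt0 : (0 < e %/ h)%N by rewrite divn_gt0 // dvdn_leq.
have h2_gt0 : (0 < 2 * h)%N by rewrite muln_gt0.
have nh_gt0 : (0 < n %/ (2 * h))%N by rewrite divn_gt0 // dvdn_leq.
have odd_eh : odd (e %/ h) = (logn 2 e <= logn 2 n./2)%N.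
  by rewrite odd_logn // logn_div // lh subn_eq0 leq_min leqnn andbT.
have odd_nh : odd (n %/ (2 * h)) = (logn 2 n./2 <= logn 2 e)%N.
  have l2 : logn 2 2 = 1%N by rewrite logn_prime.
  by rewrite odd_logn // logn_div // subn_eq0 lognM // lh sE l2 add1n ltnS leq_min leqnn.
pose c : int := b ^+ (e %/ h).
have cN0 : c != 0 by rewrite expf_neq0.
have cg : c ^+ h = - a by rewrite aE opprK -exprM divnK.
pose omega : algC := alpha ^+ (n %/ h) / c%:~R.
have omegah : omega ^+ h = -1.
  rewrite expr_div_n -exprM divnK // alphan -(rmorphXn intr) /= cg rmorphN /=.
  by rewrite invrN mulrN divff // intr_eq0.
have yE : alpha ^+ (n %/ h) = c%:~R * omega by rewrite mulrC divfK // intr_eq0.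
have ht : (h %| t)%N.
  apply/tP => //; rewrite yE; apply/inCyc_intM => //.
  rewrite -[omega]mulr1; apply/(inCyc_rootM _ h2n)/(@inCyc_int n 1) => //.
  by rewrite mulnC exprM omegah sqrrN expr1n.
have t2e : (t %| 2 * e)%N.
  by apply: (kummer_index_dvd n_gt0 alphan a_gt0 emax tn); apply/tP.
have t2h : (t %| 2 * h)%N by rewrite /h muln_gcdr dvdn_gcd t2e -nE tn.
have /dvdnP[j tE] := ht.
have j2 : (j %| 2)%N by rewrite -(@dvdn_pmul2r h) // -tE.
have {j2} jE : j = (if (2 * h %| t)%N then 2 else 1)%N.
  rewrite tE dvdn_pmul2r //.
  by case: j j2 {tE} => [|[|[|j]]] // /dvdn_leq.
rewrite tE mulnC {}jE; congr (_ * (if _ then _ else _))%N.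
suff core : inCyc n (alpha ^+ (n %/ (2 * h))) <-> C.
  by apply/idP/idP => [t2|CT]; [apply/core/tP|apply/tP => //; apply/core].
set Y := alpha ^+ _; pose eta : algC := sqrtC omega; pose rho : algC := sqrtC b%:~R.
have eta2 : eta ^+ 2 = omega by rewrite sqrtCK.
have rho2 : rho ^+ 2 = b%:~R by rewrite sqrtCK.
have rhoN0 : rho != 0 by rewrite sqrtC_eq0 intr_eq0.
have Y2 : Y ^+ 2 = c%:~R * eta ^+ 2.
  rewrite eta2 -yE -exprM; congr (_ ^+ _).
  by rewrite [(2 * h)%N]mulnC divnMA divnK // dvdn_divRL.
have eta2h : eta ^+ (2 * h) = -1 by rewrite exprM eta2.
have eta4h : eta ^+ (2 * (2 * h)) = 1 by rewrite mulnC exprM eta2h sqrrN expr1n.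
have etaN0 : eta != 0.
  by rewrite sqrtC_eq0; apply/eqP => om0; move/eqP: omegah;
    rewrite om0 expr0n gtn_eqF // eq_sym oppr_eq0 oner_eq0.
have n2_gt0' : (0 < 2 * n)%N by rewrite muln_gt0.
have eta2n : forall w, inCyc (2 * n) (eta * w) <-> inCyc (2 * n) w.
  by move=> w; apply: (inCyc_rootM w _ _ eta4h); rewrite ?muln_gt0 ?dvdn_pmul2l.
have n4_rho k : (0 < k)%N -> (4 %| k)%N -> inCyc k rho <-> (`|quad_disc d| %| k)%N.
  move=> k_gt0 k4.
  rewrite -(sqrt_squareM_cyclotomicP (r := 'i * rho) f_gt0 sqf a0E) //; last first.
    by rewrite exprMn sqrCi rho2 /b rmorphN /= mulN1r opprK.
  by rewrite (inCyc_rootM rho k4) // -[4%N]/(2 * 2)%N exprM sqrCi sqrrN expr1n.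
have co : coprime n.+1 (2 * n).
  by rewrite coprimeMr coprimen2 oddS n_even coprime_sym coprimenS.
have [nu nuP] := Qn_aut_exists co.
have nufix w : inCyc n w -> nu w = w.
  apply: (@inCyc_fixed n n.+1) => [x xn|]; last by rewrite -addn1 modnDl.
  by apply: nuP; rewrite mulnC exprM xn expr1n.
have nueta : nu eta = eta * (-1) ^+ (n %/ (2 * h)).
  have eta_n : eta ^+ n = (-1) ^+ (n %/ (2 * h)).
    by rewrite -{1}(divnK h2n) mulnC exprM eta2h.
  by rewrite nuP ?exprS ?eta_n // mulnC exprM eta_n -exprM mulnC exprM sqrrN !expr1n.
have eta_notin : odd (n %/ (2 * h)) -> nu eta != eta.
  move=> o; rewrite nueta -signr_odd o expr1 mulrN1 eq_sym -subr_eq0 opprK.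
  by rewrite -mulr2n mulrn_eq0 negb_or etaN0.
have [j' [m [DE m_odd _ j'_case]]] := quad_disc_shape sqf.
have Ddvd k : (`|quad_disc d| %| 2 ^ k * n)%N = (m %| n)%N && (j' <= k + logn 2 n)%N.
  rewrite DE Gauss_dvd ?coprimeXl ?coprime2n // (@Gauss_dvdr m) ?coprimeXr ?coprimen2 //.
  rewrite andbC; congr (_ && _).
  by rewrite pfactor_dvdn ?muln_gt0 ?expn_gt0 // lognM ?expn_gt0 // pfactorK.
have D8 : (8 %| `|quad_disc d|)%N = (3 <= j')%N.
  have m_gt0 : (0 < m)%N by case: (m) m_odd.
  rewrite -[8%N]/(2 ^ 3)%N DE pfactor_dvdn ?muln_gt0 ?expn_gt0 // lognM ?expn_gt0 //.
  by rewrite pfactorK // logn_coprime ?addn0 // coprime2n.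
have n2k k : (2 ^ k %| n)%N = (k <= logn 2 n)%N by rewrite pfactor_dvdn.
have CE : C = [&& m %| n, j' <= 3 + logn 2 n & (logn 2 e + 2 <= logn 2 n) ||
    [&& logn 2 e == 1, 3 <= j', 2 <= logn 2 n & ~~ (3 <= logn 2 n)]]%N.
  rewrite /C D8 -[4%N]/(2 ^ 2)%N -[8%N]/(2 ^ 3)%N Ddvd !n2k -andbA.
  by [].
have v_odd_even : ~~ odd (e %/ h) -> exists2 k : int, k != 0 & Y ^+ 2 = (k%:~R * eta)
  ^+ 2.
  move=> eh; exists (b ^+ (e %/ h)./2); first by rewrite expf_neq0.
  rewrite Y2 exprMn -(rmorphXn intr) /= -exprM muln2 -[X in X.*2]add0n.
  by rewrite add0n -[X in b ^+ X.*2]add0n /c -{1}(odd_double_half (e %/ h)) (negPf eh).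
have v_odd_odd : odd (e %/ h) ->
    exists2 k : int, k != 0 & Y ^+ 2 = (k%:~R * (eta * rho)) ^+ 2.
  move=> eh; exists (b ^+ (e %/ h)./2); first by rewrite expf_neq0.
  rewrite Y2 !exprMn rho2 /c -{1}(odd_double_half (e %/ h)) eh -muln2 add1n exprS exprM.
  by rewrite rmorphM (rmorphXn _ 2) /=; ring.
have disc_n : (`|quad_disc d| %| n)%N = (m %| n)%N && (j' <= logn 2 n)%N.
  by have := Ddvd 0%N; rewrite mul1n add0n.
have disc_2n : (`|quad_disc d| %| 2 * n)%N = (m %| n)%N && (j' <= (logn 2 n).+1)%N.
  by have := Ddvd 1%N; rewrite expn1 add1n.
have n4 : (2 <= logn 2 n -> 4 %| n)%N by move=> s2; rewrite -[4%N]/(2 ^ 2)%N n2k.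
rewrite CE; have [nh_odd|nh_even] := boolP (odd (n %/ (2 * h))); last first.
  have v_lt : (logn 2 e < logn 2 n./2)%N by rewrite ltnNge -odd_nh.
  have [|k kN0 Y2E] := v_odd_odd; first by rewrite odd_eh ltnW.
  have -> : (logn 2 e + 2 <= logn 2 n)%N by rewrite sE addn2 ltnS.
  have s3 : (3 <= logn 2 n)%N by rewrite sE ltnS; apply: leq_trans v_lt.
  rewrite (inCyc_sqrE _ Y2E) (inCyc_intM _ _ kN0) (inCyc_rootM _ _ _ eta4h) ?muln_gt0
    //; last first.
    by rewrite -dvdn_divRL // dvdn2.
  rewrite (n4_rho _ n_gt0) ?n4 ?(ltnW s3) // disc_n orTb andbT.
  rewrite (leq_trans _ s3) 1?(leq_trans _ (leq_addr _ 3)) //.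
    by case/or3P: j'_case => /eqP->.
  by case/or3P: j'_case => /eqP->.
have s_le : (logn 2 n <= (logn 2 e).+1)%N by rewrite sE ltnS -odd_nh.
have -> : (logn 2 e + 2 <= logn 2 n)%N = false by rewrite addn2 ltnNge s_le.
rewrite orFb; have nueta' := eta_notin nh_odd.
have [eh_odd|eh_even] := boolP (odd (e %/ h)); last first.
  have [k kN0 Y2E] := v_odd_even eh_even.
  rewrite (inCyc_sqrE _ Y2E) (inCyc_intM _ _ kN0).
  split=> [/nufix/eqP|]; first by rewrite (negPf nueta').
  case/and5P => _ _ /eqP v1 _ /andP[s2 s3]; exfalso; move/negP: eh_even; apply.
  by rewrite odd_eh v1 -ltnS -sE.
have [k kN0 Y2E] := v_odd_odd eh_odd.
rewrite (inCyc_sqrE _ Y2E) (inCyc_intM _ _ kN0).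
have sv : logn 2 n = (logn 2 e).+1.
  by apply/eqP; rewrite eqn_leq s_le sE ltnS -odd_eh.
have s2 : (2 <= logn 2 n)%N by rewrite sv ltnS.
have nueta2 : nu eta = - eta by rewrite nueta -signr_odd nh_odd expr1 mulrN1.
have n4rho := n4_rho n n_gt0 (n4 s2).
have n4rho2 := n4_rho (2 * n)%N n2_gt0' (dvdn_mull 2 (n4 s2)).
transitivity ((`|quad_disc d| %| 2 * n)%N /\ ~ (`|quad_disc d| %| n)%N).
  split=> [er|[D2n Dn]].
    have er2 : inCyc (2 * n) (eta * rho) by apply: inCyc_dvd er; rewrite ?dvdn_mull.
    split; first by apply/n4rho2/eta2n.
    move=> /n4rho rn; have := nufix _ er; rewrite rmorphM /= (nufix _ rn) nueta2.
    by move=> /(mulIf rhoN0)/eqP; rewrite -nueta2 (negPf nueta').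
  have r2n : inCyc (2 * n) rho by apply/n4rho2.
  have fixed w : inCyc (2 * n) w -> nu w = w -> inCyc n w.
    exact: (cyclotomic_half_fixed n_gt0 n_even nuP).
  have : nu rho ^+ 2 == rho ^+ 2 by rewrite -rmorphXn /= rho2 rmorph_int.
  rewrite eqf_sqr => /orP[/eqP nur|/eqP nur].
    by case: Dn; apply/n4rho/fixed.
  apply: fixed; first by apply/eta2n.
  by rewrite rmorphM /= nueta2 nur mulrNN.
rewrite disc_2n disc_n sv.
case: (m %| n)%N; last by split=> [[]|].
case/or3P: j'_case => /eqP->; move: v_gt0; case: (logn 2 e) => [|[|v]] // _;
  split=> //=; case=> //.
Qed.

End KummerTwisted.

(** * Euler products *)

Section EulerProduct.

Variables (R : realType) (g : nat -> nat -> R).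
Hypothesis g_ge0 : forall p k, 0 <= g p k.

Definition euler_term (N n : nat) : R :=
  \prod_(0 <= p < N | prime p) g p (logn p n).

Lemma euler_term_ge0 N n : 0 <= euler_term N n.
Proof. by apply: prodr_ge0 => p _; apply: g_ge0. Qed.

Lemma euler_termS N n : euler_term N.+1 n =
  euler_term N n * (if prime N then g N (logn N n) else 1).
Proof.
by rewrite /euler_term big_mkcond big_nat_recr //= -big_mkcond.
Qed.

(** Expand the product of the truncated local sums: its terms correspond to
    the integers whose prime factors are below N with exponents below K. When
    the bound passes a prime N, each of them gives rise to its multiples by the
    powers of N. *)
Lemma smooth_numbers_sum (N K : nat) : (0 < K)%N -> exists s : seq nat,
  [/\ uniq s,
      forall n, (n \in s) <->
        [/\ (0 < n)%N, forall p, prime p -> (p %| n)%N -> (p < N)%N &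
            forall p, prime p -> (p < N)%N -> (logn p n < K)%N] &
      \sum_(n <- s) euler_term N n =
        \prod_(0 <= p < N | prime p) \sum_(0 <= k < K) g p k].
Proof.
move=> K_gt0; elim: N => [|N [s [s_uniq s_mem s_sum]]].
  exists [:: 1%N]; split=> //.
    move=> n; rewrite inE; split=> [/eqP->|[n_gt0 n1 _]].
      by split=> // p p_pr; rewrite dvdn1 => /eqP p1; rewrite p1 in p_pr.
    case: n n_gt0 n1 => [|[|n]] // _ /(_ (pdiv n.+2) (pdiv_prime _)) n1.
    by have := n1 isT (pdiv_dvd _).
  by rewrite big_seq1 /euler_term !big_geq.
have [N_pr|N_npr] := boolP (prime N); last first.
  have ltNS p : prime p -> (p < N.+1)%N = (p < N)%N.
    move=> p_pr; rewrite ltnS leq_eqVlt; case: eqP => // pN.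
    by rewrite -pN p_pr in N_npr.
  exists s; split=> //.
    move=> n; rewrite s_mem; split=> -[n_gt0 nN nK]; split=> // p p_pr.
    - by rewrite ltNS //; apply: nN.
    - by rewrite ltNS //; apply: nK.
    - by rewrite -ltNS //; apply: nN.
    - by rewrite -ltNS //; apply: nK.
  rewrite [RHS]big_mkcond big_nat_recr //= (negPf N_npr) mulr1 -big_mkcond -s_sum.
  by apply: eq_bigr => n _; rewrite euler_termS (negPf N_npr) mulr1.
have N_gt0 := prime_gt0 N_pr.
have s_coprime m : m \in s -> (0 < m)%N /\ ~~ (N %| m)%N.
  move=> /s_mem[m_gt0 mN _]; split=> //; apply/negP => /(mN N N_pr).
  by rewrite ltnn.
have logN m k : m \in s -> logn N (m * N ^ k) = k.
  move=> /s_coprime[m_gt0 Nm]; rewrite lognM ?expn_gt0 ?N_gt0 // pfactorK //.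
  by rewrite logn_coprime // prime_coprime.
have logp p m k : prime p -> p != N -> (0 < m)%N -> logn p (m * N ^ k) = logn p m.
  move=> p_pr pN m_gt0; rewrite lognM ?expn_gt0 ?N_gt0 // lognX.
  have -> : logn p N = 0%N by rewrite logn_coprime // prime_coprime // dvdn_prime2.
  by rewrite muln0 addn0.
exists [seq (m * N ^ k)%N | m <- s, k <- index_iota 0 K]; split.
- apply: allpairs_uniq => //; first exact: iota_uniq.
  move=> [m k] [m' k'] /allpairsP[[m1 k1] /= [m1s _ [-> ->]]].
  move=> /allpairsP[[m2 k2] /= [m2s _ [-> ->]]] E.
  have kk : k1 = k2 by rewrite -(logN m1 k1 m1s) E logN.
  move: E; rewrite kk => /eqP; rewrite eqn_pmul2r ?expn_gt0 ?N_gt0 // => /eqP->.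
  by [].
- move=> n; split=> [/allpairsP[[m k] /= [ms]]|[n_gt0 nN nK]].
    rewrite mem_index_iota => /andP[_ kK] ->.
    have [m_gt0 Nm] := s_coprime m ms; have [_ mN mK] := (s_mem m).1 ms.
    split=> [|p p_pr|p p_pr].
    + by rewrite muln_gt0 m_gt0 expn_gt0 N_gt0.
    + rewrite Euclid_dvdM // => /orP[/(mN p p_pr)/ltnW //|].
      by rewrite Euclid_dvdX // dvdn_prime2 // => /andP[/eqP-> _].
    + rewrite ltnS leq_eqVlt; case: eqVneq => [-> _|pN /=]; first by rewrite logN.
      by move=> plt; rewrite logp //; apply: mK.
  have Nn : (N ^ logn N n %| n)%N by apply: pfactor_dvdnn.
  have m_gt0 : (0 < n %/ N ^ logn N n)%N.
    by rewrite divn_gt0 ?expn_gt0 ?N_gt0 // dvdn_leq.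
  apply/allpairsP; exists (n %/ N ^ logn N n, logn N n)%N; split=> /=.
  + apply/s_mem; split=> //.
      move=> p p_pr pn; have := nN p p_pr (dvdn_trans pn (dvdn_div Nn)).
      rewrite ltnS leq_eqVlt => /orP[/eqP pN|//]; exfalso; move: pn; rewrite pN.
      apply/negP; rewrite -(expn1 N) {2}(expn1 N) pfactor_dvdn // logn_div //.
      by rewrite pfactorK // subnn.
    move=> p p_pr pN; apply: leq_ltn_trans (nK p p_pr (ltnW pN)).
    by rewrite logn_div // leq_subr.
  + by rewrite mem_index_iota /= nK.
  + by rewrite divnK.
rewrite [RHS]big_mkcond big_nat_recr //= N_pr -big_mkcond -s_sum /=.
rewrite big_allpairs_dep big_distrl /=; apply: eq_big_seq => m ms.
rewrite big_distrr /=; apply: eq_bigr => k _.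
rewrite euler_termS N_pr logN //; congr (_ * _).
have [m_gt0 _] := s_coprime m ms.
rewrite /euler_term big_nat_cond [RHS]big_nat_cond.
apply: eq_bigr => p /andP[/andP[_ pN] p_pr].
by rewrite logp // ltn_eqF.
Qed.

Lemma sum_uniq_sub (s1 s2 : seq nat) (h : nat -> R) : uniq s1 -> uniq s2 ->
  {subset s1 <= s2} -> (forall n, 0 <= h n) -> \sum_(n <- s1) h n <= \sum_(n <- s2) h n.
Proof.
move=> u1 u2 sub h_ge0; rewrite [leRHS](bigID (mem s1)) /=.
rewrite -[X in X + _]big_filter.
have -> : \sum_(n <- [seq i <- s2 | i \in s1]) h n = \sum_(n <- s1) h n.
  apply: perm_big; apply: uniq_perm; rewrite ?filter_uniq // => n.
  by rewrite mem_filter; case: (boolP (n \in s1)) => // /sub ->.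
by rewrite lerDl sumr_ge0.
Qed.

Variables (G F : nat -> R) (B : nat).
Hypothesis gG : forall p, prime p -> (fun K => \sum_(0 <= k < K) g p k) @ \oo --> G p.
(* Only from some bound B on is F n the product of the local terms: finitely many
   primes may have g p 0 <> 1. *)
Hypothesis FE : forall N n, (B <= N)%N -> (0 < n)%N ->
  (forall p, prime p -> (p %| n)%N -> (p < N)%N) -> F n = euler_term N n.

Let P N := \prod_(0 <= p < N | prime p) G p.
Let S N := \sum_(1 <= n < N.+1) F n.

Hypothesis P_bounded : exists C, forall N, P N <= C.

Let F_ge0 n : (0 < n)%N -> 0 <= F n.
Proof.
move=> n_gt0; rewrite (@FE (maxn B n.+1)) ?euler_term_ge0 ?leq_maxl //.
by move=> p _ pn; rewrite leq_max orbC ltnS dvdn_leq.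
Qed.

Let local_le p K : prime p -> \sum_(0 <= k < K) g p k <= G p.
Proof.
move=> p_pr; apply: (@cvgr_to_ge _ _ _ _ _ _ _ (gG p_pr)).
near=> K'; have KK' : (K <= K')%N by near: K'; exists K.
by rewrite [leRHS](@big_cat_nat _ _ _ K) //= lerDl sumr_ge0.
Unshelve. all: end_near. Qed.

Let P_lim N :
  (fun K => \prod_(0 <= p < N | prime p) \sum_(0 <= k < K) g p k) @ \oo --> P N.
Proof.
rewrite /P; elim: N => [|N IH].
  by rewrite big_geq //; under eq_fun do rewrite big_geq //; apply: cvg_cst.
rewrite big_mkcond big_nat_recr //= -big_mkcond /=.
under eq_fun do rewrite big_mkcond big_nat_recr //= -big_mkcond /=.
apply: cvgM => //; case: ifP => [N_pr|_]; last exact: cvg_cst.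
exact: gG.
Qed.

Let S_le_P M N : (B <= N)%N -> (M < N)%N -> S M <= P N.
Proof.
move=> BN MN; have [s [s_uniq s_mem s_sum]] := @smooth_numbers_sum N M.+1 isT.
apply: (@le_trans _ _ (\sum_(n <- s) euler_term N n)); last first.
  rewrite s_sum; apply: ler_prod => p p_pr; rewrite local_le // sumr_ge0 //.
rewrite /S (eq_big_nat _ _ (F2 := euler_term N)); last first.
  move=> n /andP[n_gt0 nM]; apply: FE => // p _ pn.
  by apply: leq_ltn_trans (dvdn_leq n_gt0 pn) _; apply: leq_ltn_trans MN.
apply: sum_uniq_sub => //; [exact: iota_uniq| |by move=> n; apply: euler_term_ge0].
move=> n; rewrite mem_index_iota => /andP[n_gt0 nM]; apply/s_mem; split=> //.
  move=> p _ pn; apply: leq_ltn_trans (dvdn_leq n_gt0 pn) _.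
  exact: leq_ltn_trans MN.
by move=> p _ _; apply: leq_trans nM; rewrite ltnS ltnW // ltn_logl.
Qed.

(** All terms are nonnegative. The integers up to M are among those with prime
    factors below N as soon as M < N, so S M <= P N, which bounds S; and a
    truncation of P N is a sum of finitely many values of F, so P N is at most
    lim S. Hence P is squeezed towards lim S. *)
Theorem euler_product_cvg : exists l : R, P @ \oo --> l /\ S @ \oo --> l.
Proof.
have S_nd : nondecreasing_seq S.
  apply/nondecreasing_seqP => M; rewrite /S [leRHS]big_nat_recr //= lerDl.
  exact: F_ge0.
have S_cvg : cvgn S.
  apply: nondecreasing_is_cvgn => //; have [C PC] := P_bounded.
  exists C => _ [M _ <-]; apply: le_trans (PC (maxn B M.+1)).
  by apply: S_le_P; rewrite ?leq_maxl ?leq_maxr.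
exists (limn S); split=> //.
have S_le M : S M <= limn S by apply: nondecreasing_cvgn_le.
have P_le N : (B <= N)%N -> P N <= limn S.
  move=> BN; apply: (@cvgr_to_le _ _ _ _ _ _ _ (@P_lim N)).
  near=> K; have K_gt0 : (0 < K)%N by near: K; exists 1%N.
  have [s [s_uniq s_mem s_sum]] := @smooth_numbers_sum N K K_gt0.
  rewrite -s_sum; apply: le_trans (S_le (\max_(n <- s) n)).
  rewrite /S (eq_big_seq F) => [|n /s_mem[n_gt0 nN _]]; last by rewrite (@FE N).
  rewrite (eq_big_seq (fun n => if (0 < n)%N then F n else 0)); last first.
    by move=> n /s_mem[-> _ _].
  rewrite [leRHS](eq_big_nat _ _ (F2 := fun n => if (0 < n)%N then F n else 0));
    last first.
    by move=> n /andP[-> _].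
  apply: sum_uniq_sub => //; first exact: iota_uniq.
    move=> n ns; rewrite mem_index_iota ltnS; have [-> _ _] := (s_mem n).1 ns.
    exact: (leq_bigmax_seq (F := id)).
  by move=> n; case: ifP => // n_gt0; apply: F_ge0.
apply: (@squeeze_cvgr _ _ _ _ (fun N => S N.-1) (cst (limn S))).
- near=> N; have BN : (B <= N)%N by near: N; exists B.
  have N_gt0 : (0 < N)%N by near: N; exists 1%N.
  by rewrite S_le_P ?prednK // P_le.
- rewrite -(cvg_shiftS (fun N => S N.-1)) /=; exact: S_cvg.
- exact: cvg_cst.
Unshelve. all: end_near. Qed.

End EulerProduct.

(** * Local factors *)

Section LocalFactors.

Variable R : realType.

(** The exponent of p in the index t, apart from the possible extra factor 2,
    when k is the exponent of p in n. In the twisted case b = true (a < 0 and e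
    even) the root of -1 takes one factor 2 of n. *)
Definition radical_exp (b : bool) (e p k : nat) : nat :=
  if b && (p == 2%N) then minn k.-1 (logn p e) else minn k (logn p e).

Definition local_weight (b : bool) (e p k : nat) : R :=
  (p ^ radical_exp b e p k)%:R / (p ^ k * totient (p ^ k))%:R.

Definition radical_part (b : bool) (e n : nat) : nat :=
  \prod_(p <- primes n) p ^ radical_exp b e p (logn p n).

(** Written over the primes of n rather than those of m, in order to compare
    the divisors m of n factor by factor. *)
Lemma prod_primes_logn n m : (0 < m)%N -> (forall p, prime p -> p %| m -> p %| n)%N ->
  (0 < n)%N -> m = (\prod_(p <- primes n) p ^ logn p m)%N.
Proof.
move=> m_gt0 sub n_gt0; rewrite [LHS](prod_prime_decomp m_gt0) prime_decompE big_map /=.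
rewrite [RHS](bigID (fun p => p %| m)%N) /= [X in (_ * X)%N]big1 ?muln1; last first.
  move=> p pm; rewrite lognE; case: ifP => // /and3P[_ _ pm']; by rewrite pm' in pm.
rewrite -[RHS]big_filter; apply: perm_big; apply: uniq_perm.
- exact: primes_uniq.
- by rewrite filter_uniq ?primes_uniq.
move=> p; rewrite mem_filter !mem_primes m_gt0 n_gt0 /=.
case: (boolP (prime p)) => //= p_pr; last by rewrite andbF.
by case: (boolP (p %| m)%N) => //= pm; rewrite sub.
Qed.

Lemma radical_part_false e n : (0 < n)%N -> (0 < e)%N -> radical_part false e n = gcdn
  n e.
Proof.
move=> n_gt0 e_gt0; rewrite [RHS](@prod_primes_logn n) ?gcdn_gt0 ?n_gt0 //.
  by apply: eq_bigr => p _; rewrite logn_gcd.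
by move=> p _; rewrite dvdn_gcd => /andP[].
Qed.

Lemma radical_part_true e n : (0 < n)%N -> (0 < e)%N ->
  radical_part true e n = if odd n then gcdn n e else gcdn n./2 e.
Proof.
move=> n_gt0 e_gt0; case: ifPn => [n_odd|n_even].
  rewrite -radical_part_false //; apply: eq_big_seq => p.
  rewrite mem_primes => /and3P[_ _ pn]; rewrite /radical_exp /=.
  by case: eqP => // p2; move: n_odd; rewrite -[odd n]negbK -dvdn2 -p2 pn.
have nE : n = (2 * n./2)%N by rewrite mul2n -[LHS]odd_double_half (negPf n_even).
have n2_gt0 : (0 < n./2)%N by move: n_gt0; rewrite {1}nE muln_gt0 => /andP[].
rewrite [RHS](@prod_primes_logn n) ?gcdn_gt0 ?n2_gt0 //; last first.
  by move=> p _; rewrite dvdn_gcd {2}nE => /andP[pn _]; rewrite dvdn_mull.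
apply: eq_big_seq => p; rewrite mem_primes => /and3P[p_pr _ _].
rewrite logn_gcd // /radical_exp /= {1 2}nE lognM // logn_prime //.
by case: eqP => [->|_].
Qed.

Lemma euler_term_local_weight b e N n : (0 < n)%N ->
  (forall p, prime p -> (p %| n)%N -> (p < N)%N) ->
  (radical_part b e n)%:R / (n * totient n)%:R = euler_term (local_weight b e) N n.
Proof.
move=> n_gt0 nN.
have -> : euler_term (local_weight b e) N n =
    \prod_(p <- primes n) local_weight b e p (logn p n).
  rewrite /euler_term (bigID (fun p => p %| n)%N) /= [X in _ * X]big1 ?mulr1; last first.
    move=> p /andP[p_pr pn]; have -> : logn p n = 0%N.
      by rewrite lognE (negPf pn) !andbF.
    rewrite /local_weight /radical_exp /= min0n if_same !expn0.
    by rewrite -[(1 * totient 1)%N]/1%N divr1.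
  rewrite -big_filter; apply: perm_big; apply: uniq_perm.
  - by rewrite filter_uniq ?iota_uniq.
  - exact: primes_uniq.
  move=> p; rewrite mem_filter mem_index_iota mem_primes n_gt0 /=.
  case: (boolP (prime p)) => //= p_pr.
  by case: (boolP (p %| n)%N) => //= pn; rewrite nN.
rewrite /local_weight big_split /= -natr_prod; congr (_ * _).
rewrite prodfV -natr_prod; congr (_%:R^-1).
rewrite big_split /= -(prod_primes_logn n_gt0) //; congr (_ * _)%N.
rewrite totientE //; apply: eq_big_seq => p; rewrite mem_primes => /and3P[p_pr _ pn].
by rewrite totient_pfactor // logn_gt0 mem_primes p_pr n_gt0.
Qed.

Lemma local_weight_ge0 b e p k : 0 <= local_weight b e p k.
Proof. by rewrite divr_ge0 ?ler0n. Qed.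

Lemma geometric_tail (u : nat -> R) (k0 : nat) (c q : R) :
    `|q| < 1 -> (forall k, (k0 <= k)%N -> u k = c * q ^+ k) ->
  (fun K => \sum_(0 <= k < K) u k) @ \oo -->
    \sum_(0 <= k < k0) u k + c * q ^+ k0 / (1 - q).
Proof.
move=> q1 uE.
rewrite -(cvg_shiftn k0) /=.
have -> : (fun K => \sum_(0 <= k < K + k0) u k) =
    (fun K => \sum_(0 <= k < k0) u k + series (geometric (c * q ^+ k0) q) K).
  apply/funext => K; rewrite (@big_cat_nat _ _ _ k0) ?leq_addl //=; congr (_ + _).
  rewrite -{1}[k0]add0n big_addn addnK seriesEnat /=; apply: eq_big_nat => k _.
  by rewrite uE ?leq_addl // /geometric /= exprD; ring.
apply: cvgD; first exact: cvg_cst.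
exact: cvg_geometric_series.
Qed.

End LocalFactors.

(** * Local sums *)

Section LocalSums.

Variable R : realType.
Implicit Types (e p k v : nat).

Notation lw := (@local_weight R).

Lemma local_weight0 b e p : lw b e p 0 = 1.
Proof.
rewrite /local_weight /radical_exp /= min0n if_same !expn0.
by rewrite -[(1 * totient 1)%N]/1%N divr1.
Qed.

Lemma local_weightS b e p k : prime p ->
  lw b e p k.+1 = p%:R ^+ radical_exp b e p k.+1 / (p%:R ^+ k.+1 * ((p%:R - 1) * p%:R
    ^+ k)).
Proof.
move=> p_pr; rewrite /local_weight totient_pfactor //= !natrM !natrX.
by rewrite -subn1 natrB ?prime_gt0.
Qed.

Lemma local_weight_small b e p k : prime p -> (0 < k)%N -> ~~ (b && (p == 2%N)) ->
  (k <= logn p e)%N -> lw b e p k = p%:R / (p%:R - 1) * p%:R^-1 ^+ k.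
Proof.
case: k => // k p_pr _ nb kv; rewrite local_weightS // /radical_exp (negPf nb).
rewrite (minn_idPl kv) exprVn !exprS.
have p0 : p%:R != 0 :> R by rewrite pnatr_eq0 -lt0n prime_gt0.
have p1 : p%:R - 1 != 0 :> R by rewrite subr_eq0 pnatr_eq1;
  case: p p_pr {kv nb p0} => [|[|]].
have pk : p%:R ^+ k != 0 :> R by rewrite expf_neq0.
move: (p%:R ^+ k) pk => X X0; by field; rewrite p0 p1 X0.
Qed.

Lemma local_weight_large b e p k : prime p -> (0 < k)%N -> ~~ (b && (p == 2%N)) ->
  (logn p e <= k)%N ->
  lw b e p k = p%:R ^+ logn p e * (p%:R / (p%:R - 1)) * (p%:R^-1 ^+ 2) ^+ k.
Proof.
case: k => // k p_pr _ nb kv; rewrite local_weightS // /radical_exp (negPf nb).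
rewrite (minn_idPr kv) -exprM mulnC exprM exprVn !exprS.
have p0 : p%:R != 0 :> R by rewrite pnatr_eq0 -lt0n prime_gt0.
have p1 : p%:R - 1 != 0 :> R by rewrite subr_eq0 pnatr_eq1;
  case: p p_pr {kv nb p0} => [|[|]].
have pk : p%:R ^+ k != 0 :> R by rewrite expf_neq0.
move: (p%:R ^+ k) (p%:R ^+ logn p e) pk => X Y X0; by field; rewrite p0 p1 X0.
Qed.

Lemma local_weight_twisted_small e k : (0 < k)%N -> (k <= (logn 2 e).+1)%N ->
  lw true e 2 k = 2^-1 ^+ k.
Proof.
case: k => // k _ kv; rewrite local_weightS // /radical_exp /= (minn_idPl _) //.
rewrite exprVn !exprS; have : (2 : R) ^+ k != 0 by rewrite expf_neq0.
by move: (2 ^+ k) => X X0; field.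
Qed.

Lemma local_weight_twisted_large e k : ((logn 2 e).+1 <= k)%N ->
  lw true e 2 k = 2 ^+ (logn 2 e).+1 * (2^-1 ^+ 2) ^+ k.
Proof.
case: k => // k kv; rewrite local_weightS // /radical_exp /= (minn_idPr _) //.
rewrite -exprM mulnC exprM exprVn !exprS.
have : (2 : R) ^+ k != 0 by rewrite expf_neq0.
by move: (2 ^+ k) (2 ^+ logn 2 e) => X Y X0; field.
Qed.

Lemma sum_geometric_from1 (x : R) v : x != 1 ->
  \sum_(1 <= k < v.+1) x ^+ k = x * (1 - x ^+ v) / (1 - x).
Proof.
move=> x1; have x1' : 1 - x != 0 by rewrite subr_eq0 eq_sym.
elim: v => [|v IH]; first by rewrite big_geq // expr0 subrr mulr0 mul0r.
by rewrite big_nat_recr //= IH exprS; move: (x ^+ v) => X; field.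
Qed.

Lemma inv_prime_sqr_lt1 p : prime p -> `|p%:R^-1 ^+ 2 : R| < 1.
Proof.
move=> p_pr; rewrite ger0_norm ?exprn_ge0 ?invr_ge0 //.
rewrite exprn_ilt1 ?invr_ge0 // invf_lt1 ?ltr0n ?prime_gt0 // ltr1n.
exact: prime_gt1.
Qed.

Lemma euler_factorE e p : prime p ->
  euler_factor R e p = 1 + \sum_(1 <= k < (logn p e).+1) p%:R / (p%:R - 1) * p%:R^-1 ^+
    k +
    p%:R ^+ logn p e * (p%:R / (p%:R - 1)) * (p%:R^-1 ^+ 2) ^+ (logn p e).+1 /
      (1 - p%:R^-1 ^+ 2).
Proof.
move=> p_pr; rewrite /euler_factor; move: (logn p e) => v.
have p0 : p%:R != 0 :> R by rewrite pnatr_eq0 -lt0n prime_gt0.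
have p_gt1 : 1 < p%:R :> R by rewrite ltr1n prime_gt1.
have p1 : p%:R - 1 != 0 :> R by rewrite subr_eq0 gt_eqF.
have p1' : p%:R + 1 != 0 :> R by rewrite gt_eqF // addr_gt0 // (lt_trans _ p_gt1).
have p2 : p%:R ^+ 2 - 1 != 0 :> R by rewrite subr_sqr_1 mulf_neq0.
have pv : p%:R ^+ v != 0 :> R by rewrite expf_neq0.
have pi1 : 1 - p%:R^-1 != 0 :> R.
  by rewrite subr_eq0 eq_sym invr_eq1 gt_eqF.
rewrite -mulr_sumr sum_geometric_from1; last by rewrite invr_eq1 gt_eqF.
have q1 : 1 - p%:R^-1 ^+ 2 != 0 :> R.
  have pV : 0 < p%:R^-1 :> R by rewrite invr_gt0 (lt_trans _ p_gt1).
  have -> : 1 - p%:R^-1 ^+ 2 = (1 - p%:R^-1) * (1 + p%:R^-1) :> R by ring.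
  by rewrite mulf_neq0 // gt_eqF // addr_gt0.
rewrite -exprM mulnC exprM [p%:R^-1 ^+ v.+1]exprS !exprD !exprVn.
move: (p%:R ^+ v) pv => X X0; move: (p%:R : R) p0 p1 p1' p2 pi1 q1 => x x0 x1 x1' x2 xi
  q1.
by field; rewrite X0 x0 x1 x2.
Qed.

Lemma sum_from0 (u : nat -> R) m : \sum_(0 <= k < m.+1) u k = u 0 + \sum_(1 <= k <
  m.+1) u k.
Proof. by rewrite big_ltn. Qed.

Lemma local_sum_from1 b e p : prime p -> ~~ (b && (p == 2%N)) ->
  (fun K => \sum_(0 <= k < K) (if (1 <= k)%N then lw b e p k else 0)) @ \oo -->
    euler_factor R e p - 1.
Proof.
move=> p_pr nb; set u := fun k : nat => if (1 <= k)%N then lw b e p k else 0.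
have uE k : (logn p e < k)%N ->
    u k = p%:R ^+ logn p e * (p%:R / (p%:R - 1)) * (p%:R^-1 ^+ 2) ^+ k.
  by case: k => // k kv; rewrite /u /= local_weight_large // ltnW.
have tail := geometric_tail (inv_prime_sqr_lt1 p_pr) uE.
have E (A B : R) : 1 + A + B - 1 = A + B by ring.
rewrite euler_factorE // {}E.
move: tail; rewrite sum_from0 {1}/u /= add0r.
suff -> : \sum_(1 <= k < (logn p e).+1) u k =
    \sum_(1 <= k < (logn p e).+1) p%:R / (p%:R - 1) * p%:R^-1 ^+ k by [].
apply: eq_big_nat => k /andP[k1 kv]; rewrite /u k1.
exact: local_weight_small.
Qed.

(** The sum from k = 1 is the excess of the local factor over 1; it is also the
    local sum restricted to the multiples of p, hence stated separately. *)
Lemma local_sum_shift (u : nat -> R) (l : R) :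
  (fun K => \sum_(0 <= k < K) (if (1 <= k)%N then u k else 0)) @ \oo --> l ->
  (fun K => \sum_(0 <= k < K) u k) @ \oo --> u 0 + l.
Proof.
move=> ul; rewrite -(cvg_shiftS (fun K => \sum_(0 <= k < K) u k)) /=.
have -> : (fun K => \sum_(0 <= k < K.+1) u k) =
    (fun K => u 0 + \sum_(0 <= k < K.+1) (if (1 <= k)%N then u k else 0)).
  apply/funext => K; rewrite !sum_from0 /= add0r; congr (_ + _).
  by apply: eq_big_nat => k /andP[-> _].
apply: cvgD; first exact: cvg_cst.
by rewrite (cvg_shiftS (fun K => \sum_(0 <= k < K) (if (1 <= k)%N then u k else 0))).
Qed.

Lemma local_sum b e p : prime p -> ~~ (b && (p == 2%N)) ->
  (fun K => \sum_(0 <= k < K) lw b e p k) @ \oo --> euler_factor R e p.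
Proof.
move=> p_pr nb; have := local_sum_shift (@local_sum_from1 b e p p_pr nb).
by rewrite local_weight0 addrC subrK.
Qed.

Lemma local_sum_tail2 e m : (logn 2 e < m)%N ->
  (fun K => \sum_(0 <= k < K) (if (m <= k)%N then lw false e 2 k else 0)) @ \oo -->
    (2 ^+ (logn 2 e).+1 * (2^-1 ^+ 2) ^+ m * (4 / 3) : R).
Proof.
move=> vm; set u := fun k : nat => if (m <= k)%N then lw false e 2 k else 0.
have uE k : (m <= k)%N -> u k = 2 ^+ (logn 2 e).+1 * (2^-1 ^+ 2) ^+ k.
  move=> mk; rewrite /u mk local_weight_large //; last exact: ltnW (leq_trans vm mk).
    by rewrite [2 ^+ (logn 2 e).+1]exprS; congr (_ * _); field.
  exact: leq_ltn_trans (leq0n _) (leq_trans vm mk).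
have := geometric_tail (inv_prime_sqr_lt1 (isT : prime 2)) uE.
rewrite big_nat_cond big1 ?add0r; last first.
  by move=> k /andP[/andP[_ km] _]; rewrite /u leqNgt km.
by have -> : 1 - 2^-1 ^+ 2 = (4 / 3)^-1 :> R; [field|rewrite invrK].
Qed.

Definition twisted_factor2 e : R :=
  1 + (2 ^+ (logn 2 e + 2) - 2 ^+ logn 2 e - 1) / (3 * 2 ^+ logn 2 e).

Lemma local_sum_twisted2 e :
  (fun K => \sum_(0 <= k < K) lw true e 2 k) @ \oo --> twisted_factor2 e.
Proof.
have := geometric_tail (inv_prime_sqr_lt1 (isT : prime 2))
  (fun k => @local_weight_twisted_large e k \o @ltnW _ _).
rewrite sum_from0 local_weight0.
have -> : \sum_(1 <= k < (logn 2 e).+2) lw true e 2 k =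
    \sum_(1 <= k < (logn 2 e).+2) 2^-1 ^+ k.
  apply: eq_big_nat => k /andP[k1 kv]; exact: local_weight_twisted_small.
rewrite sum_geometric_from1; last by rewrite invr_eq1 (eqr_nat R 2 1).
suff -> : twisted_factor2 e = 1 + 2^-1 * (1 - 2^-1 ^+ (logn 2 e).+1) / (1 - 2^-1) +
     2 ^+ (logn 2 e).+1 * (2^-1 ^+ 2) ^+ (logn 2 e).+2 / (1 - 2^-1 ^+ 2) by [].
rewrite /twisted_factor2 -exprM mulnC exprM addn2 !exprS !exprVn.
have : (2 : R) ^+ logn 2 e != 0 by rewrite expf_neq0.
by move: (2 ^+ logn 2 e) => X X0; field.
Qed.

(** The isolated term k = 2 occurs only for v = 1, where it comes just before
    the geometric tail. *)
Lemma local_sum_twisted2_tail e (sp : bool) : (0 < logn 2 e)%N -> (sp -> logn 2 e =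
  1%N) ->
  (fun K => \sum_(0 <= k < K)
     (if (logn 2 e + 2 <= k)%N || (sp && (k == 2%N)) then lw true e 2 k else 0)) @ \oo -->
    ((2 * 2 ^+ logn 2 e)^-1 / 3 + (if sp then 4^-1 else 0) : R).
Proof.
move=> v_gt0 sp1; set u := fun k : nat =>
  if (logn 2 e + 2 <= k)%N || (sp && (k == 2%N)) then lw true e 2 k else 0.
have uE k : ((logn 2 e).+2 <= k)%N -> u k = 2 ^+ (logn 2 e).+1 * (2^-1 ^+ 2) ^+ k.
  by move=> kv; rewrite /u addn2 kv /= local_weight_twisted_large // ltnW.
have := geometric_tail (inv_prime_sqr_lt1 (isT : prime 2)) uE.
have -> : \sum_(0 <= k < (logn 2 e).+2) u k = if sp then 4^-1 else 0.
  rewrite /u; case: (sp) sp1 => [/(_ isT) v1|_].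
    rewrite v1 !big_nat_recr //= big_geq // !add0r.
    rewrite local_weight_twisted_small ?v1 //.
    by rewrite exprVn; congr (_ ^-1); rewrite -natrX.
  rewrite big_nat_cond big1 // => k /andP[/andP[_ kv] _].
  by rewrite /= orbF addn2 leqNgt kv.
rewrite addrC.
suff -> : 2 ^+ (logn 2 e).+1 * (2^-1 ^+ 2) ^+ (logn 2 e).+2 / (1 - 2^-1 ^+ 2) =
    (2 * 2 ^+ logn 2 e)^-1 / 3 :> R by [].
rewrite -exprM mulnC exprM !exprS !exprVn.
have : (2 : R) ^+ logn 2 e != 0 by rewrite expf_neq0.
by move: (2 ^+ logn 2 e) => X X0; field.
Qed.

End LocalSums.

(** * Euler products restricted at finitely many primes *)

Section RestrictedEulerProduct.

Variable R : realType.

(** If p does not divide e then the excess over 1 is p / ((p - 1)(p^2 - 1)).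
    Otherwise p <= e, and the factor e makes up for a crude bound. The form
    chosen for the upper bound telescopes. *)
Lemma euler_factor_bound (e p : nat) : (0 < e)%N -> prime p ->
  1 <= euler_factor R e p <= 1 + 2 * e%:R / (p%:R * (p%:R - 1)).
Proof.
move=> e_gt0 p_pr; rewrite /euler_factor lerDl lerD2l.
have x2 : 2 <= p%:R :> R by rewrite ler_nat prime_gt1.
have e1 : 1 <= e%:R :> R by rewrite ler1n.
have X1 : 1 <= p%:R ^+ logn p e :> R by rewrite exprn_ege1 // (le_trans _ x2) // ler1n.
have pe : (logn p e = 0)%N \/ (p%:R : R) <= e%:R.
  have [->|v_gt0] := posnP (logn p e); [by left|right].
  by rewrite ler_nat dvdn_leq //; move: v_gt0; rewrite logn_gt0 mem_primes => /and3P[].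
rewrite !exprD expr1.
have pos : 0 < p%:R ^+ logn p e * (p%:R - 1) * (p%:R ^+ 2 - 1) :> R.
  have /= x1 : 0 < p%:R - 1 :> R by lra.
  have /= x3 : 0 < p%:R ^+ 2 - 1 :> R by nra.
  by rewrite !mulr_gt0 // (lt_le_trans ltr01).
have pos2 : 0 < p%:R * (p%:R - 1) :> R by nra.
apply/andP; split; first by rewrite divr_ge0 ?(ltW pos) //; nra.
rewrite ler_pdivrMr // mulrAC ler_pdivlMr //.
case: pe => [v0|pe].
  rewrite v0 expr0; move: (p%:R : R) (e%:R : R) x2 e1 => x y x2 y1.
  rewrite !mul1r.
  have -> : (x ^+ 2 + x - x ^+ 2) * (x * (x - 1)) = x ^+ 2 * (x - 1) by ring.
  have -> : 2 * y * ((x - 1) * (x ^+ 2 - 1)) = 2 * y * (x ^+ 2 - 1) * (x - 1) by ring.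
  have x4 : 4 <= x ^+ 2 by rewrite expr2; nra.
  have y2 : 2 * (x ^+ 2 - 1) <= 2 * y * (x ^+ 2 - 1) by apply: ler_wpM2r; lra.
  by apply: ler_wpM2r; lra.
move: (p%:R : R) (e%:R : R) (p%:R ^+ logn p e : R) x2 e1 X1 pe {pos pos2}.
move=> x y X x2 y1 X1 xy.
have -> : 2 * y * (X * (x - 1) * (x ^+ 2 - 1)) = (X * (x + 1) * (x - 1)) * (2 * y * (x
  - 1)).
  by ring.
apply: (@le_trans _ _ ((X * x ^+ 2 + X * x) * (x * (x - 1)))).
  by apply: ler_wpM2r; [nra|rewrite gerBl exprn_ge0 //; lra].
have -> : (X * x ^+ 2 + X * x) * (x * (x - 1)) = (X * (x + 1) * (x - 1)) * (x * x) by
  ring.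
apply: ler_wpM2l; first by rewrite !mulr_ge0 //; lra.
nra.
Qed.

(** Use 1 + x <= exp x and 1 / (p (p - 1)) = 1 / (p - 1) - 1 / p. *)
Lemma euler_product_bounded (e : nat) : (0 < e)%N ->
  exists C : R, forall N, \prod_(0 <= p < N | prime p) euler_factor R e p <= C.
Proof.
move=> e_gt0; exists (expR (2 * e%:R)).
have prod_ge0 N : 0 <= \prod_(0 <= p < N | prime p) euler_factor R e p.
  apply: prodr_ge0 => p p_pr; have /andP[] := euler_factor_bound e_gt0 p_pr.
  by move=> /(le_trans ler01).
have key N : \prod_(0 <= p < N.+2 | prime p) euler_factor R e p <=
    expR (2 * e%:R * (1 - N.+1%:R^-1)).
  elim: N => [|N IH].
    by rewrite big_mkcond !big_nat_recr //= big_geq // invr1 subrr mulr0 expR0 !mulr1.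
  rewrite big_mkcond big_nat_recr //= -big_mkcond /=.
  have -> : 2 * e%:R * (1 - N.+2%:R^-1) =
      2 * e%:R * (1 - N.+1%:R^-1) + 2 * e%:R / (N.+2%:R * (N.+2%:R - 1)) :> R.
    have -> : N.+2%:R = N.+1%:R + 1 :> R by rewrite -addn1 natrD.
    have : 0 < N.+1%:R :> R by rewrite ltr0n.
    move: (N.+1%:R : R) => y y0; by field; rewrite addrK !gt_eqF ?addr_gt0.
  rewrite expRD; apply: ler_pM => //.
    by case: ifP => // p_pr; have /andP[] := euler_factor_bound e_gt0 p_pr;
      move=> /(le_trans ler01).
  case: ifP => [p_pr|_].
    have /andP[_ le1] := euler_factor_bound e_gt0 p_pr.
    exact: le_trans le1 (expR_ge1Dx _).
  by rewrite -expR0 ler_expR divr_ge0 ?mulr_ge0.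
case=> [|[|N]].
- by rewrite big_geq // -expR0 ler_expR mulr_ge0.
- by rewrite big_mkcond big_nat1 /= -expR0 ler_expR mulr_ge0.
by apply: le_trans (key N) _; rewrite ler_expR ler_piMr ?mulr_ge0 // gerBl invr_ge0.
Qed.

Variables (b : bool) (e : nat) (Q : seq nat) (C : nat -> pred nat) (Gb Gx : nat -> R).
Hypothesis e_gt0 : (0 < e)%N.
Hypothesis Q_uniq : uniq Q.
Hypothesis Q_prime : forall p, p \in Q -> prime p.

Let lw := @local_weight R b e.
Let gx p k : R := if (p \in Q) ==> C p k then lw p k else 0.

Hypothesis Gb_lim : forall p, prime p -> (fun K => \sum_(0 <= k < K) lw p k) @ \oo -->
  Gb p.
Hypothesis Gx_lim : forall p, p \in Q ->
  (fun K => \sum_(0 <= k < K) (if C p k then lw p k else 0)) @ \oo --> Gx p.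
Hypothesis Gb_bounded : forall p, prime p -> 1 <= Gb p <= euler_factor R e p.

Definition base_term n : R := (radical_part b e n)%:R / (n * totient n)%:R.
Definition restricted_term n : R :=
  if all (fun p => C p (logn p n)) Q then base_term n else 0.

Let Gx' p := if p \in Q then Gx p else Gb p.
Let Pb N := \prod_(0 <= p < N | prime p) Gb p.
Let B := (\max_(p <- Q) p).+1.

Let lw_ge0 p k : 0 <= lw p k. Proof. exact: local_weight_ge0. Qed.

Let gx_ge0 p k : 0 <= gx p k. Proof. by rewrite /gx; case: ifP. Qed.

Let gx_lim p : prime p -> (fun K => \sum_(0 <= k < K) gx p k) @ \oo --> Gx' p.
Proof.
by move=> p_pr; rewrite /gx /Gx'; case: ifP => pQ /=; [apply: Gx_lim|apply: Gb_lim].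
Qed.

Let Gx_le p : prime p -> 0 <= Gx' p <= Gb p.
Proof.
move=> p_pr; apply/andP; split.
  apply: (@cvgr_to_ge _ _ _ _ _ _ _ (gx_lim p_pr)).
  by near=> K; rewrite sumr_ge0.
rewrite -(cvg_lim _ (gx_lim p_pr)) // -(cvg_lim _ (Gb_lim p_pr)) //.
apply: ler_lim.
- exact: cvgP (gx_lim p_pr).
- exact: cvgP (Gb_lim p_pr).
near=> K; apply: ler_sum => k _; rewrite /gx; case: ifP => // _; exact: lw_ge0.
Unshelve. all: end_near. Qed.

Let Pb_bounded : exists c, forall N, Pb N <= c.
Proof.
have [c Pc] := euler_product_bounded e_gt0; exists c => N.
apply: le_trans (Pc N); apply: ler_prod => p p_pr.
by have /andP[G1 ->] := Gb_bounded p_pr; rewrite (le_trans ler01 G1).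
Qed.

Let Px_bounded : exists c, forall N, \prod_(0 <= p < N | prime p) Gx' p <= c.
Proof.
have [c Pc] := Pb_bounded; exists c => N.
by apply: le_trans (Pc N); apply: ler_prod => p p_pr; apply: Gx_le.
Qed.

Let restricted_termE N n : (B <= N)%N -> (0 < n)%N ->
  (forall p, prime p -> (p %| n)%N -> (p < N)%N) -> restricted_term n = euler_term gx N n.
Proof.
move=> BN n_gt0 nN; rewrite /restricted_term /base_term (@euler_term_local_weight _ _ _
  N) //.
have QN p : p \in Q -> (p < N)%N.
  by move=> pQ; apply: leq_trans BN; rewrite ltnS; apply: (leq_bigmax_seq (F := id)).
case: (boolP (all _ Q)) => [allQ|].
  apply: eq_bigr => p _; rewrite /gx; case: ifP => // /negP[].
  by apply/implyP => pQ; apply: (allP allQ).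
move=> /allPn[q qQ Cq]; rewrite /euler_term big_mkcond (bigD1_seq q) ?iota_uniq //=.
  by rewrite Q_prime // /gx qQ (negPf Cq) mul0r.
by rewrite mem_index_iota QN.
Qed.

Let ratio_prod N : (B <= N)%N -> \prod_(0 <= p < N | prime p) Gx' p =
  (\prod_(q <- Q) (Gx q / Gb q)) * Pb N.
Proof.
move=> BN.
have -> : \prod_(q <- Q) (Gx q / Gb q) =
    \prod_(0 <= p < N | prime p) (if p \in Q then Gx p / Gb p else 1).
  rewrite -big_mkcondr /= -[RHS]big_filter; apply: perm_big; apply: uniq_perm => //.
    by rewrite filter_uniq ?iota_uniq.
  move=> p; rewrite mem_filter mem_index_iota /=.
  case: (boolP (p \in Q)) => [pQ|_]; last by rewrite andbF.
  rewrite Q_prime //=; apply/esym; apply: leq_trans BN.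
  by rewrite ltnS; apply: (leq_bigmax_seq (F := id)).
rewrite -big_split /=; apply: eq_bigr => p p_pr; rewrite /Gx'.
case: ifP => _; last by rewrite mul1r.
have /andP[G1 _] := Gb_bounded p_pr.
by rewrite divfK // gt_eqF // (lt_le_trans ltr01).
Qed.

(** Both sums have Euler products, and the local factors are the same outside
    the finite set Q. *)
Theorem restricted_euler_product : exists l : R,
  [/\ Pb @ \oo --> l,
      (fun N => \sum_(1 <= n < N.+1) base_term n) @ \oo --> l &
      (fun N => \sum_(1 <= n < N.+1) restricted_term n) @ \oo -->
        (\prod_(q <- Q) (Gx q / Gb q)) * l].
Proof.
have [l [Pl Sl]] : exists l : R, Pb @ \oo --> l /\
    (fun N => \sum_(1 <= n < N.+1) base_term n) @ \oo --> l.
  apply: (@euler_product_cvg R lw lw_ge0 Gb base_term 0%N Gb_lim) => // N n _ n_gt0 nN.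
  by rewrite /base_term (euler_term_local_weight R b e n_gt0 nN).
have [lx [Pxl Sxl]] := euler_product_cvg gx_ge0 gx_lim restricted_termE Px_bounded.
exists l; split=> //.
suff <- : lx = (\prod_(q <- Q) (Gx q / Gb q)) * l by [].
have Pxl' : (fun N => (\prod_(q <- Q) (Gx q / Gb q)) * Pb N) @ \oo -->
    (\prod_(q <- Q) (Gx q / Gb q)) * l by apply: cvgMr.
have Pxl2 : (fun N => \prod_(0 <= p < N | prime p) Gx' p) @ \oo -->
    (\prod_(q <- Q) (Gx q / Gb q)) * l.
  apply: cvg_trans Pxl'; apply: near_eq_cvg.
  by near=> N; rewrite ratio_prod //; near: N; exists B.
exact: (cvg_unique _ Pxl Pxl2).
Unshelve. all: end_near. Qed.

End RestrictedEulerProduct.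

(** * From degrees to local conditions *)

Definition local_cond (C2 : pred nat) (p : nat) : pred nat :=
  if p == 2%N then C2 else leq 1.

Lemma all_local_cond (C2 : pred nat) (D : int) (j m n : nat) :
    `|D|%N = (2 ^ j * m)%N -> odd m -> squarefree m -> (0 < n)%N ->
  all (fun p => local_cond C2 p (logn p n)) (primes `|(2 * D)%R|%N) =
    C2 (logn 2 n) && (m %| n)%N.
Proof.
move=> DE m_odd m_sqf n_gt0; have m_gt0 := squarefree_gt0 m_sqf.
have D2E : `|(2 * D)%R|%N = (2 ^ j.+1 * m)%N by rewrite abszM DE mulnA expnS.
have memQ p : (p \in primes `|(2 * D)%R|%N) = prime p && ((p == 2%N) || (p %| m)%N).
  rewrite D2E mem_primes muln_gt0 expn_gt0 m_gt0 /=.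
  case: (boolP (prime p)) => //= p_pr.
  by rewrite Euclid_dvdM // Euclid_dvdX // dvdn_prime2 // andbT.
apply/allP/andP => [allQ|[C2n mn] p].
  split.
    have /allQ : 2%N \in primes `|(2 * D)%R|%N by rewrite memQ.
    by rewrite /local_cond eqxx.
  apply: squarefree_prime_dvd => // p p_pr pm.
  have /allQ : p \in primes `|(2 * D)%R|%N by rewrite memQ p_pr pm orbT.
  rewrite /local_cond; case: eqP => [p2|_].
    by move: m_odd; rewrite -[odd m]negbK -dvdn2 -p2 pm.
  by rewrite logn_gt0 mem_primes => /and3P[].
rewrite memQ => /andP[p_pr]; rewrite /local_cond; case: eqP => [-> //|_ /=] pm.
by rewrite logn_gt0 mem_primes p_pr n_gt0 (dvdn_trans pm mn).
Qed.

Section FinalSums.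

Variable R : realType.

Lemma inv_degQ (n t : nat) (z x : algC) : (0 < n)%N -> (t %| n)%N ->
  degQ [:: z; x] = (totient n * (n %/ t))%N ->
  1 / (degQ [:: z; x])%:R = t%:R / (n * totient n)%:R :> R.
Proof.
move=> n_gt0 tn ->; have t_gt0 := dvdn_gt0 n_gt0 tn.
have /dvdnP[k nE] := tn; have k_gt0 : (0 < k)%N by move: n_gt0;
  rewrite nE muln_gt0 => /andP[].
rewrite nE mulnK // !natrM.
have : (totient (k * t))%:R != 0 :> R by rewrite pnatr_eq0 -lt0n totient_gt0 -nE.
have : t%:R != 0 :> R by rewrite pnatr_eq0 -lt0n.
have : k%:R != 0 :> R by rewrite pnatr_eq0 -lt0n.
move: (k%:R : R) (t%:R : R) ((totient (k * t))%:R : R) => x1 x2 x3 h1 h2 h3.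
by field; rewrite h1 h2 h3.
Qed.

Lemma euler_factor_ratio e p : prime p ->
  (euler_factor R e p - 1) / euler_factor R e p = disc_factor R e p.
Proof.
move=> p_pr; rewrite /euler_factor /disc_factor /=; move: (logn p e) => v.
have p_gt1 : 1 < p%:R :> R by rewrite ltr1n prime_gt1.
have pv : 1 <= p%:R ^+ v :> R by rewrite exprn_ege1 // ltW.
rewrite !exprD expr1.
move: (p%:R ^+ v : R) pv => X X1; move: (p%:R : R) p_gt1 => x x1.
have den : X * x ^+ 3 + X - x ^+ 2 != 0.
  have -> : X * x ^+ 3 + X - x ^+ 2 = X * (x ^+ 3 + 1) - x ^+ 2 by ring.
  rewrite gt_eqF //.
  have x3 : x ^+ 2 <= x ^+ 3 by rewrite ler_weXn2l // ltW.
  have x30 : 0 <= x ^+ 3 by apply: exprn_ge0; lra.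
  have : 0 <= (X - 1) * (x ^+ 3 + 1) by apply: mulr_ge0; lra.
  lra.
have X0 : X != 0 by rewrite gt_eqF //; lra.
have x0 : x - 1 != 0 by rewrite gt_eqF //; lra.
have x2 : x ^+ 2 - 1 != 0 by rewrite subr_sqr_1 mulf_neq0 // gt_eqF //; lra.
have E : 1 + (X * x ^+ 2 + X * x - x ^+ 2) / (X * (x - 1) * (x ^+ 2 - 1)) =
   (X * x ^+ 3 + X - x ^+ 2) / (X * (x - 1) * (x ^+ 2 - 1)).
  by field; rewrite X0 x0 x2.
rewrite {2}E addrAC subrr add0r invf_div mulrA divfK //.
by rewrite !mulf_neq0.
Qed.

End FinalSums.

(** * The sum of the reciprocal degrees *)

Lemma dvdn_pow2_odd (j m k n : nat) : (0 < n)%N -> odd m ->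
  (2 ^ j * m %| 2 ^ k * n)%N = (j <= k + logn 2 n)%N && (m %| n)%N.
Proof.
move=> n_gt0 m_odd.
rewrite Gauss_dvd ?coprimeXl ?coprime2n // (@Gauss_dvdr m) ?coprimeXr ?coprimen2 //.
congr (_ && _).
by rewrite pfactor_dvdn ?muln_gt0 ?expn_gt0 // lognM ?expn_gt0 // pfactorK.
Qed.

Lemma exactly_divides2 (D : int) (j m k : nat) : `|D|%N = (2 ^ j * m)%N -> odd m ->
  exactly_divides 2 k D = (j == k).
Proof.
move=> DE m_odd; have m_gt0 : (0 < m)%N by case: (m) m_odd.
have E i : ((2 ^ i)%N%:Z %| D)%Z = (i <= j)%N.
  rewrite dvdzE /= DE pfactor_dvdn ?muln_gt0 ?expn_gt0 // lognM ?expn_gt0 //.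
  by rewrite pfactorK // logn_coprime ?addn0 // coprime2n.
by rewrite /exactly_divides !E -leqNgt -eqn_leq eq_sym.
Qed.

Section MainCases.

Variables (R : realType) (a a0 d : int) (e f : nat) (zeta alpha : nat -> algC).
Hypothesis a_neq0 : a != 0.
Hypothesis emax : is_max_exponent e `|a|%N.
Hypothesis f_gt0 : (0 < f)%N.
Hypothesis sqf : squarefree `|d|%N.
Hypothesis a0E : a0 = d * f%:Z ^+ 2.
Hypothesis zeta_prim : forall n : nat, (0 < n)%N -> n.-primitive_root (zeta n).
Hypothesis alpha_root : forall n : nat, (0 < n)%N -> alpha n ^+ n = a%:~R.

Let D := quad_disc d.
Let v := logn 2 e.
Let Q := primes `|(2 * D)%R|%N.
Let e_gt0 : (0 < e)%N. Proof. by case: emax. Qed.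
Let partial_sum (N : nat) : R := \sum_(1 <= n < N.+1) 1 / (degQ [:: zeta n; alpha n])%:R.

Let Q_prime p : p \in Q -> prime p.
Proof. by rewrite mem_primes => /and3P[]. Qed.

Let Q2 : 2%N \in Q.
Proof.
have d_gt0 := squarefree_gt0 sqf.
rewrite mem_primes /= abszM dvdn_mulr // muln_gt0 /= /D /quad_disc.
by case: ifP; rewrite ?andbT // abszM muln_gt0.
Qed.

Let partial_sumE (b : bool) (C : nat -> pred nat) :
  (forall n, (0 < n)%N -> forall t, (t %| n)%N ->
    (forall j, (j %| n)%N -> inCyc n (alpha n ^+ (n %/ j)) <-> (j %| t)%N) ->
    t = (radical_part b e n * (if all (fun p => C p (logn p n)) Q then 2 else 1))%N) ->
  forall N, partial_sum N = \sum_(1 <= n < N.+1) base_term R b e n +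
                            \sum_(1 <= n < N.+1) restricted_term R b e Q C n.
Proof.
move=> tE N; rewrite -big_split /=; apply: eq_big_nat => n /andP[n_gt0 _].
have [t [tn degE tP]] := kummer_index n_gt0 a_neq0 (alpha_root n_gt0) (zeta_prim n_gt0).
rewrite (inv_degQ _ n_gt0 tn degE) (tE n n_gt0 t tn tP) /restricted_term /base_term.
by case: ifP => _; rewrite natrM ?mulr1 ?addr0 // mulrAC mulr_natr mulr2n.
Qed.

Lemma ratio_at_2 (mm : nat) : (v < mm)%N ->
  (2 ^+ v.+1 * (2^-1 ^+ 2) ^+ mm * (4 / 3)) / euler_factor R e 2 =
  (4 ^+ (mm - v.+1))^-1 / (3 * 2 ^+ v - 2) * disc_factor R e 2.
Proof.
move=> vm; set i := (mm - v.+1)%N.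
have pE : (2^-1 ^+ 2) ^+ mm = (4 * (2 ^+ v) ^+ 2 * 4 ^+ i)^-1 :> R.
  rewrite -(subnKC vm) -/i.
  have -> : 2^-1 ^+ 2 = 4^-1 :> R by field.
  rewrite exprVn exprD exprS; congr (_ * _ * _)^-1.
  have -> : 4 = 2 ^+ 2 :> R by ring.
  by rewrite -!exprM mulnC.
rewrite pE /euler_factor /disc_factor /= -/v !exprD !exprS !expr0 !mulr1.
have X1 : 1 <= 2 ^+ v :> R by rewrite exprn_ege1 // ler1n.
have Y0 : 0 < 4 ^+ i :> R by rewrite exprn_gt0.
move: (2 ^+ v : R) X1 (4 ^+ i : R) Y0 => X X1 Y Y0.
have X0 : X != 0 by rewrite gt_eqF //; lra.
have h1 : 3 * X - 2 != 0 by rewrite gt_eqF //; lra.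
have h2 : X * 8 + X - 4 != 0 by rewrite gt_eqF //; lra.
by field; rewrite h1 h2 X0 gt_eqF.
Qed.

(** The restriction at 2 is that the valuation of n be at least max(v + 1, j),
    where j is the valuation of the discriminant. Each unit by which j exceeds
    v + 1 divides the geometric tail by 4. *)
Lemma c0_case1E (j m : nat) : `|D|%N = (2 ^ j * m)%N -> odd m ->
    [|| j == 0, j == 2 | j == 3]%N ->
  c0_case1 R D e = (4 ^+ (maxn v.+1 j - v.+1))^-1.
Proof.
move=> DE m_odd; rewrite /c0_case1 !(exactly_divides2 _ DE m_odd) -/v.
case/or3P => /eqP-> /=.
- by rewrite maxn0 subnn expr0 invr1.
- case: v => [|v'] /=; first by rewrite expr1 mul1r.
  by rewrite (maxn_idPl _) // subnn expr0 invr1.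
- case: v => [|[|v']] /=.
  + by rewrite div1r; congr (_^-1); rewrite -natrX.
  + by rewrite expr1 mul1r.
  + by rewrite (maxn_idPl _) // subnn expr0 invr1.
Qed.

(** By kummer_index_perfect the reciprocal degree is the weight
    gcd(n, e) / (n phi(n)), counted twice if 2^(v+1) and D divide n. This is a
    restriction on the valuations at the primes of 2 D: at least max(v + 1, j)
    at 2, at least 1 elsewhere, the odd part of D being squarefree. *)
Lemma density_perfect_power : a = a0 ^+ e -> exists l : R,
  (fun N => prime_prod predT (@euler_factor R e) N) @ \oo --> l /\
  partial_sum @ \oo --> (1 + c0_case1 R D e / (3 * 2 ^+ v - 2)
            * \prod_(p <- Q) disc_factor R e p) * l.
Proof.
move=> aE; have [j [m [DE m_odd m_sqf j_case]]] := quad_disc_shape sqf.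
pose mm := maxn v.+1 j; have vm : (v < mm)%N by apply: leq_maxl.
pose C := local_cond (leq mm).
pose Gx p : R := if p == 2%N then 2 ^+ v.+1 * (2^-1 ^+ 2) ^+ mm * (4 / 3)
  else euler_factor R e p - 1.
have Gb_lim p : prime p ->
    (fun K => \sum_(0 <= k < K) local_weight R false e p k) @ \oo --> euler_factor R e p.
  by move=> p_pr; apply: local_sum.
have Gx_lim p : p \in Q -> (fun K => \sum_(0 <= k < K)
    (if C p k then local_weight R false e p k else 0)) @ \oo --> Gx p.
  move=> /Q_prime p_pr; rewrite /C /local_cond /Gx; case: eqP => [->|_].
    exact: local_sum_tail2.
  exact: local_sum_from1.
have Gb_bd p : prime p -> 1 <= euler_factor R e p <= euler_factor R e p.
  by move=> p_pr; rewrite lexx andbT; have /andP[] := euler_factor_bound R e_gt0 p_pr.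
have [l [Pl Sl Sx]] := restricted_euler_product e_gt0 (primes_uniq _) Q_prime Gb_lim
  Gx_lim Gb_bd.
exists l; split.
  by under eq_fun do (rewrite /prime_prod; under eq_bigl do rewrite andbT).
have -> : partial_sum = (fun N => \sum_(1 <= n < N.+1) base_term R false e n +
                            \sum_(1 <= n < N.+1) restricted_term R false e Q C n).
  apply/funext; apply: partial_sumE => n n_gt0 t tn tP.
  rewrite (kummer_index_perfect n_gt0 a_neq0 emax f_gt0 sqf a0E (alpha_root n_gt0) aE
    tn tP).
  rewrite radical_part_false //; congr (_ * (if _ then _ else _))%N.
  have := @dvdn_pow2_odd j m 0 n n_gt0 m_odd; rewrite mul1n add0n -DE => Dn.
  by rewrite (all_local_cond _ DE) // Dn pfactor_dvdn // geq_max -andbA.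
have -> : c0_case1 R D e / (3 * 2 ^+ v - 2) * \prod_(p <- Q) disc_factor R e p =
    \prod_(q <- Q) (Gx q / euler_factor R e q).
  rewrite (bigD1_seq 2%N) ?primes_uniq //= [RHS](bigD1_seq 2%N) ?primes_uniq //=.
  rewrite mulrA {1}/Gx eqxx ratio_at_2 // (c0_case1E DE) //; congr (_ * _).
  rewrite big_seq_cond [RHS]big_seq_cond; apply: eq_bigr => p /andP[pQ p2].
  by rewrite /Gx (negPf p2) euler_factor_ratio // Q_prime.
by rewrite mulrDl mul1r; apply: cvgD.
Qed.

Lemma twisted_ratio_at_2 (sp : bool) : (sp -> v = 1%N) ->
  ((2 * 2 ^+ v)^-1 / 3 + (if sp then 4^-1 else 0)) / twisted_factor2 R e =
  (if sp then 4 else 1) / (3 * 2 ^+ (v + 2) - 2).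
Proof.
rewrite /twisted_factor2 -/v => spv; rewrite !exprD.
have X1 : 1 <= 2 ^+ v :> R by rewrite exprn_ege1 // ler1n.
case: sp spv => [/(_ isT) -> | _]; first by field.
move: (2 ^+ v : R) X1 => X X1.
have X0 : X != 0 by rewrite gt_eqF //; lra.
have h1 : 3 * (X * 4) - 2 != 0 by rewrite gt_eqF //; lra.
have h2 : 3 * X + (X * 4 - X - 1) != 0 by rewrite gt_eqF //; lra.
by field; rewrite h1 h2 X0.
Qed.

Lemma twisted_factor2_bound : 1 <= twisted_factor2 R e <= euler_factor R e 2.
Proof.
rewrite /twisted_factor2 /euler_factor /= -/v lerDl lerD2l !exprD expr1.
have X1 : 1 <= 2 ^+ v :> R by rewrite exprn_ege1 // ler1n.
move: (2 ^+ v : R) X1 => X X1.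
have X3 : 0 < 3 * X by lra.
rewrite divr_ge0 ?(ltW X3) //=; last by lra.
rewrite (_ : X * (2 - 1) * (2 ^+ 2 - 1) = 3 * X); last by ring.
by rewrite ler_pM2r ?invr_gt0 //; lra.
Qed.

(** The weights are those of kummer_index_twisted_odd and
    kummer_index_twisted_even. The doubling is again a restriction on
    valuations at the primes of 2 D; at 2 the valuation has to be at least
    v + 2, or exactly 2 if v = 1 and 8 divides D. *)
Lemma density_twisted_power : a = - (- a0) ^+ e -> ~~ odd e -> exists l : R,
  (fun N => prime_prod (fun p => p != 2%N) (@euler_factor R e) N) @ \oo --> l /\
  partial_sum @ \oo --> (1 + c0_case2 R D e / (3 * 2 ^+ (v + 2) - 2)
            * \prod_(p <- primes `|D|%N | p != 2%N) disc_factor R e p)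
     * twisted_factor2 R e * l.
Proof.
move=> aE e_even; have [j [m [DE m_odd m_sqf j_case]]] := quad_disc_shape sqf.
have v_gt0 : (0 < v)%N by rewrite logn_gt0 mem_primes e_gt0 dvdn2.
pose sp := (v == 1)%N && (3 <= j)%N.
have spv : sp -> v = 1%N by case/andP => /eqP.
pose C := local_cond (fun k => (v + 2 <= k)%N || (sp && (k == 2%N))).
pose Gb p : R := if p == 2%N then twisted_factor2 R e else euler_factor R e p.
pose Gx p : R := if p == 2%N then (2 * 2 ^+ v)^-1 / 3 + (if sp then 4^-1 else 0)
  else euler_factor R e p - 1.
have Gb_lim p : prime p ->
    (fun K => \sum_(0 <= k < K) local_weight R true e p k) @ \oo --> Gb p.
  move=> p_pr; rewrite /Gb; case: eqP => [->|/eqP p2]; first exact: local_sum_twisted2.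
  exact: local_sum.
have Gx_lim p : p \in Q -> (fun K => \sum_(0 <= k < K)
    (if C p k then local_weight R true e p k else 0)) @ \oo --> Gx p.
  move=> /Q_prime p_pr; rewrite /C /local_cond /Gx; case: eqP => [->|/eqP p2].
    exact: local_sum_twisted2_tail.
  exact: local_sum_from1.
have Gb_bd p : prime p -> 1 <= Gb p <= euler_factor R e p.
  move=> p_pr; rewrite /Gb; case: eqP => [->|_]; first exact: twisted_factor2_bound.
  by rewrite lexx andbT; have /andP[] := euler_factor_bound R e_gt0 p_pr.
have [l [Pl Sl Sx]] := restricted_euler_product e_gt0 (primes_uniq _) Q_prime Gb_lim
  Gx_lim Gb_bd.
have TF0 : twisted_factor2 R e != 0.
  by have /andP[T1 _] := twisted_factor2_bound; rewrite gt_eqF // (lt_le_trans ltr01).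
exists ((twisted_factor2 R e)^-1 * l); split.
  have Pl' : (fun N => (twisted_factor2 R e)^-1 * \prod_(0 <= p < N | prime p) Gb p) @
    \oo -->
      (twisted_factor2 R e)^-1 * l by apply: cvgMr.
  apply: cvg_trans Pl'; apply: near_eq_cvg; near=> N.
  have N2 : (2 < N)%N by near: N; exists 3%N.
  rewrite big_mkcond (bigD1_seq 2%N) ?iota_uniq ?mem_index_iota //=.
  rewrite {1}/Gb eqxx mulKf // /prime_prod -big_mkcondr /=.
  rewrite [LHS](eq_bigl (fun p => prime p && (p != 2%N))) => [|p]; last by rewrite andbC.
  by apply: eq_bigr => p /andP[_ p2]; rewrite /Gb (negPf p2).
have -> : partial_sum = (fun N => \sum_(1 <= n < N.+1) base_term R true e n +
                            \sum_(1 <= n < N.+1) restricted_term R true e Q C n).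
  apply/funext; apply: partial_sumE => n n_gt0 t tn tP.
  have m_gt0 := squarefree_gt0 m_sqf.
  rewrite radical_part_true // (all_local_cond _ DE) //.
  case: ifPn => [n_odd|n_even].
    rewrite (kummer_index_twisted_odd n_gt0 a_neq0 emax f_gt0 sqf a0E (alpha_root
      n_gt0) aE n_odd tn tP).
    have -> : logn 2 n = 0%N by rewrite logn_coprime // coprime2n.
    by rewrite addn2 andbF muln1.
  rewrite (kummer_index_twisted_even n_gt0 a_neq0 emax f_gt0 sqf a0E (alpha_root n_gt0)
    aE e_even n_even tn tP).
  congr (_ * (if _ then _ else _))%N; rewrite -/D -/v.
  have n2k k : (2 ^ k %| n)%N = (k <= logn 2 n)%N by rewrite pfactor_dvdn.
  have D8 : (8 %| `|D|)%N = (3 <= j)%N.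
    have := @dvdn_pow2_odd 3 1 j m m_gt0 isT; rewrite muln1 -DE dvd1n andbT => ->.
    by rewrite (logn_coprime (p := 2)) ?coprime2n // addn0.
  rewrite D8 -[4%N]/(2 ^ 2)%N -[8%N]/(2 ^ 3)%N DE dvdn_pow2_odd // !n2k.
  have -> : (j <= 3 + logn 2 n)%N.
    by apply: leq_trans (leq_addr _ _); case/or3P: j_case => /eqP->.
  rewrite /= andbC; congr (_ && _); congr (_ || _); rewrite /sp -!andbA;
    congr (_ && (_ && _)).
  by rewrite -leqNgt eqn_leq andbC.
have -> : c0_case2 R D e / (3 * 2 ^+ (v + 2) - 2) *
      \prod_(p <- primes `|D|%N | p != 2%N) disc_factor R e p =
    \prod_(q <- Q) (Gx q / Gb q).
  rewrite [RHS](bigD1_seq 2%N) ?primes_uniq //= {1}/Gx {1}/Gb eqxx twisted_ratio_at_2 //.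
  congr (_ / _ * _).
    rewrite /c0_case2 (exactly_divides2 _ DE m_odd) -/v /sp andbC.
    by case/or3P: j_case => /eqP->.
  have -> : \prod_(p <- primes `|D|%N | p != 2%N) disc_factor R e p =
      \prod_(p <- Q | p != 2%N) disc_factor R e p.
    rewrite -big_filter -[RHS]big_filter; apply: perm_big; apply: uniq_perm.
    - by rewrite filter_uniq ?primes_uniq.
    - by rewrite filter_uniq ?primes_uniq.
    move=> p; rewrite !mem_filter /Q abszM !mem_primes muln_gt0 /=.
    case: (eqVneq p 2%N) => //= p2; case: (boolP (prime p)) => //= p_pr.
    have pn2 : (p %| 2)%N = false by rewrite dvdn_prime2 //; apply/negbTE.
    by rewrite Euclid_dvdM // pn2.
  rewrite big_seq_cond [RHS]big_seq_cond; apply: eq_bigr => p /andP[pQ p2].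
  by rewrite /Gx /Gb (negPf p2) euler_factor_ratio // Q_prime.
rewrite -mulrA mulVKf // mulrDl mul1r; exact: cvgD.
Unshelve. all: end_near. Qed.

End MainCases.

Theorem proposition1p4 (R : realType) (a a0 D : int) (e : nat)
    (zeta alpha : nat -> algC)
    (a_neq0 : a <> 0) (a_neq1 : a <> 1) (a_neqN1 : a <> -1)
    (e_max : is_max_exponent e `|a|%N)
    (a0_abs : `|a|%N = (`|a0| ^ e)%N)
    (a0_sgn : sgz a0 = sgz a)
    (D_disc : is_discriminant (Qadj [:: sqrtC (a0%:~R : algC)]) D)
    (zeta_prim : forall n : nat, (0 < n)%N -> n.-primitive_root (zeta n))
    (alpha_root : forall n : nat, (0 < n)%N -> alpha n ^+ n = a%:~R) :
  let partial_sum (N : nat) : R :=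
    \sum_(1 <= n < N.+1) 1 / (degQ [:: zeta n; alpha n])%:R in
  let all_primes (N : nat) : R :=
    prime_prod predT (@euler_factor R e) N in
  let odd_primes (N : nat) : R :=
    prime_prod (fun p => p != 2%N) (@euler_factor R e) N in
  ((odd e \/ 0 < a) ->
     cvgn all_primes /\
     partial_sum @ \oo -->
       (1 + c0_case1 R D e / (3 * 2 ^+ logn 2 e - 2)
            * \prod_(p <- primes `|(2 * D)%R|%N) disc_factor R e p)
       * limn all_primes) /\
  ((~~ odd e /\ a < 0) ->
     cvgn odd_primes /\
     partial_sum @ \oo -->
       (1 + c0_case2 R D e / (3 * 2 ^+ (logn 2 e + 2) - 2)
            * \prod_(p <- primes `|D|%N | p != 2%N) disc_factor R e p)
       * (1 + (2 ^+ (logn 2 e + 2) - 2 ^+ logn 2 e - 1) / (3 * 2 ^+ logn 2 e))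
       * limn odd_primes).
Proof.
move=> partial_sum all_primes odd_primes.
move/eqP: a_neq0 => a_neq0'.
have a_gt0 : (0 < `|a|)%N by rewrite absz_gt0.
have [e_gt0 [c ac] e_maximal] := e_max.
have a0_neq0' : a0 != 0.
  by apply: contraNneq a_neq0' => a00; rewrite -sgz_eq0 -a0_sgn a00 sgz0.
have [d [f [f_gt0 sqf a0E]]] := squarefree_decompz a0_neq0'.
have d_neq1 : d != 1.
  (* If d = 1 then |a0| is a square, and |a| is a perfect (2e)-th power. *)
  apply/eqP => d1; have a0f : `|a0|%N = (f ^ 2)%N by rewrite a0E d1 mul1r abszX.
  have /e_maximal : (0 < 2 * e)%N by rewrite muln_gt0.
  have pp : is_perfect_power (2 * e) `|a|%N by exists f; rewrite a0_abs a0f expnM.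
  by move=> /(_ pp); rewrite leqNgt -{1}(mul1n e) ltn_pmul2r.
have DE := is_discriminant_sqrt f_gt0 sqf d_neq1 a0E D_disc.
have absX : `|a0 ^+ e|%N = `|a|%N by rewrite abszX.
split=> [case_pos|[e_even a_lt0]].
  have aE : a = a0 ^+ e.
    rewrite [LHS]intEsg [RHS]intEsg absX sgzX a0_sgn; congr (_ * _).
    case: case_pos => [e_odd|a_pos]; last by rewrite gtr0_sgz // expr1n.
    by rewrite sgz_odd // e_odd expr1.
  have [l [Pl Sl]] := density_perfect_power R a_neq0' e_max f_gt0 sqf a0E zeta_prim
    alpha_root aE.
  by split; [apply: cvgP Pl|rewrite DE (cvg_lim _ Pl)].
have aE : a = - (- a0) ^+ e.
  have a0_lt0 : a0 < 0 by rewrite -sgz_lt0 a0_sgn sgz_lt0.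
  have aX : `|a|%N%:Z = `|a0|%N%:Z ^+ e by rewrite a0_abs -rmorphXn /= natrXE.
  by rewrite -(ltr0_norm a0_lt0) -abszE -aX abszE ltr0_norm // opprK.
have [l [Pl Sl]] := density_twisted_power R a_neq0' e_max f_gt0 sqf a0E zeta_prim
  alpha_root aE e_even.
by split; [apply: cvgP Pl|rewrite DE (cvg_lim _ Pl)].
Qed.
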